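(* Let $X_0=x\in(0,1)$ and let $\varepsilon_n=\frac1{\gamma_{n+1}}-\frac1{\gamma_n}-\pi$ for $n\ge1$, with positive part $\varepsilon_n^+=\max(\varepsilon_n,0)$. (a) If $\sum_n\gamma_n\varepsilon_n^+<+\infty$, then $\sum_n(1-X_n)<+\infty$ almost surely on the set $\{X_\infty=1\}$. (b) If $\liminf_n\varepsilon_n>0$, then $\sum_n\gamma_n^2e^{\pi\Gamma_n}<+\infty$, and, on the event $\{Y_\infty=0\}$, $\sum_n(1-X_n)<+\infty$ almost surely.
   Context: Let $0<p_B<p_A<1$ and $\pi=p_A-p_B>0$. Let $(\gamma_n)_{n\ge1}$ be a deterministic sequence in $(0,1)$ with $\Gamma_n=\sum_{k=1}^n\gamma_k\to+\infty$. Let $(U_n)_{n\ge1}$ be i.i.d. uniform random variables on $[0,1]$, and let $(A_n)_{n\ge1}$, $(B_n)_{n\ge1}$ be events with $\mathbb{P}(A_n)=p_A$, $\mathbb{P}(B_n)=p_B$ for all $n$; the pairs $(\mathbf 1_{A_n},\mathbf 1_{B_n})_{n\ge1}$ are independent in $n$ (no assumption is made on the dependence between $A_n$ and $B_n$), and the sequence $(\mathbf 1_{A_n},\mathbf 1_{B_n})_{n\ge1}$ is independent of $(U_n)_{n\ge1}$. The two-armed bandit algorithm is defined by $X_0=x$ and $$X_{n+1}=X_n+\gamma_{n+1}\left(\mathbf 1_{\{U_{n+1}\le X_n\}\cap A_{n+1}}(1-X_n)-\mathbf 1_{\{U_{n+1}>X_n\}\cap B_{n+1}}X_n\right),\quad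 n\ge0.$$ The sequence $(X_n)$ takes values in $[0,1]$ and converges a.s. to a random variable $X_\infty$ with values in $\{0,1\}$ a.s. Set $$\theta_n=\prod_{k=1}^n(1-\gamma_k\pi X_{k-1}),\qquad Y_n=\frac{1-X_n}{\theta_n},\quad n\in\mathbb{N}$$ (with $\theta_0=1$). The sequence $(Y_n)$ is a non-negative martingale with respect to the filtration generated by $(U_n,\mathbf 1_{A_n},\mathbf 1_{B_n})_{n\ge1}$, and $Y_\infty=\lim_{n\to\infty}Y_n$ denotes its a.s. limit. *)

(* Defs.v *)
From HB Require Import structures.
From mathcomp Require Import all_boot all_order all_algebra.
From mathcomp Require Import all_classical all_reals all_analysis.

Set Implicit Arguments.
Unset Strict Implicit.
Unset Printing Implicit Defensive.
Import Order.TTheory GRing.Theory Num.Theory.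
Import numFieldNormedType.Exports.
Local Open Scope classical_set_scope.
Local Open Scope ring_scope.

(* The sequences that start at 1 (gamma, U, A, B, eps) are functions on nat
   whose value at 0 is never used; hence the restrictions to 0 < n below.
   The gap, usually written pi, is pA - pB. *)

Section independence.
Context d (T : measurableType d) (R : realType) (P : probability T R).

Definition sigma_of d' (T' : measurableType d') (Z : T -> T') : set (set T) :=
  preimage_set_system setT Z measurable.

Definition sigma_seq d' (T' : measurableType d') (Z : nat -> T -> T') :
    set (set T) :=
  <<s \bigcup_(n in [set n | (0 < n)%N]) sigma_of (Z n) >>.

Definition independent_seq d' (T' : measurableType d') (Z : nat -> T -> T') :=
  forall (s : seq nat) (E : nat -> set T),
    uniq s -> (forall n, n \in s -> (0 < n)%N) ->
    (forall n, n \in s -> sigma_of (Z n) (E n)) ->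
    P (\bigcap_(n in [set` s]) E n) = (\prod_(n <- s) P (E n))%E.

(* No measurability is required here: meant for classes F, G of measurable
   sets, such as the sigma-algebras sigma_seq of two sequences. *)
Definition independent_classes (F G : set (set T)) :=
  forall E E' : set T, F E -> G E' -> P (E `&` E') = (P E * P E')%E.

End independence.

Definition indic_pair (R : realType) (T : Type) (A B : nat -> set T)
    (n : nat) (w : T) : R * R :=
  (\1_(A n) w, \1_(B n) w).

Section bandit.
Context (R : realType) (T : Type) (pA pB x : R) (gamma : nat -> R).
Context (U : nat -> T -> R) (A B : nat -> set T).

Fixpoint bandit (n : nat) : T -> R :=
  if n is m.+1 then fun w =>
    bandit m w + gamma m.+1 *
      (\1_([set v | U m.+1 v <= bandit m v] `&` A m.+1) w * (1 - bandit m w)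
       - \1_([set v | U m.+1 v > bandit m v] `&` B m.+1) w * bandit m w)
  else fun=> x.

Definition Gamma (n : nat) : R := \sum_(1 <= k < n.+1) gamma k.

Definition eps (n : nat) : R := (gamma n.+1)^-1 - (gamma n)^-1 - (pA - pB).

Definition theta (n : nat) (w : T) : R :=
  \prod_(1 <= k < n.+1) (1 - gamma k * (pA - pB) * bandit k.-1 w).

Definition Ymart (n : nat) (w : T) : R := (1 - bandit n w) / theta n w.

End bandit.

Definition as_limit d (T : measurableType d) (R : realType)
    (P : probability T R) (Z : nat -> T -> R) (Zoo : T -> R) : Prop :=
  {ae P, forall w, Z n w @[n --> \oo] --> Zoo w}.

(* Main.v *)
Require Import Defs.
From mathcomp Require Import all_boot all_order all_algebra.
From mathcomp Require Import all_classical all_reals all_analysis.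
From mathcomp Require Import ring lra.

Set Implicit Arguments.
Unset Strict Implicit.
Unset Printing Implicit Defensive.
Import Order.TTheory GRing.Theory Num.Theory.
Import numFieldNormedType.Exports.
Local Open Scope classical_set_scope.
Local Open Scope ring_scope.

(** Write X_n for the bandit, pi = pA - pB and V_n = (1 - X_n) / gamma_n. A one-step
    computation (step_ratio) gives the expected increment of V given the past:
      (1 - X_n) (eps_n + pi (1 - X_n)).
    A success of the second arm has conditional probability pB (1 - X_n) and
    raises V by about 1, so the sum of the 1 - X_n is governed by the
    fluctuations and by the drift of V. Both parts show that V is bounded on the
    event considered, then read the sum off a bounded function of V.

    On the event where X tends to 1. The drift pi gamma_(n+1) X_n (1 - X_n) of X
    is summable, because X is bounded; since gamma_n = O(gamma_(n+1)), so is
    gamma_n (1 - X_n). The expected relative growth of V is at most the load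
    gamma_n eps_n^+ + pi gamma_n (1 - X_n), which is therefore summable, and
    ln (1 + V), corrected by the accumulated load, is a supermartingale: V is bounded
    (log_ratio_drift, ae_ratio_bounded). While V stays bounded, the concave
    function 2 K1 V - V^2 loses in mean the conditional variance of V, at least
    pB X^2 (1 - X), up to the load (ratio_variance, ae_bad_moves_summable). So the
    sum of X^2 (1 - X) is finite, and X tends to 1.

    On the event where Y tends to 0, with eps_n >= c > 0. The coefficient
    beta_n = gamma_(n+1) / theta_(n+1) then decreases at relative rate c gamma, and since
    Y is a martingale with one-step variance O(gamma_(n+1) Y_n beta_n), its
    variance after time n is O(Y_n beta_n). By Chebyshev's inequality Y is below
    Y_n / 2 at a given later time with probability O(beta_n / Y_n), which is
    O(1 / K) if n is the first time when (1 - X_n) / gamma_(n+1) > K. Hence this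
    ratio is bounded when Y tends to 0 (halving_super, ae_next_ratio_bounded). As V
    now has drift at least c (1 - X_n), its boundedness makes the sum of 1 - X_n
    finite (ratio_drift_ge, ae_summable_of_next_ratio_bounded).

    Only four outcomes per step matter, so all these processes are functions of
    finite words and conditional expectations are sums of four terms. The probability
    space enters through P_hist, which identifies the law of the word, and through
    null_event, which replaces martingale convergence: an event is
    negligible if nonnegative supermartingales with arbitrarily small initial values
    are eventually at least 1 on it. *)

(** * Histories of the bandit as words *)

(** Step k of the algorithm only depends on two bits: whether the first arm is
    chosen (U_k at most X_(k-1)), and whether the arm that is played succeeds.
    A word lists the pairs of bits of a history, latest step first, so that
    every adapted process is a function on words, defined by recursion. *)
Notation word := (seq (bool * bool)).

Section chain.
Context (R : realType) (pA pB x : R) (gamma : nat -> R).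

Definition jump (k : nat) (t : R) (c : bool * bool) : R :=
  t + gamma k * ((c.1 && c.2)%:R * (1 - t) - (~~ c.1 && c.2)%:R * t).

Fixpoint pos (s : word) : R :=
  if s is c :: s' then jump (size s) (pos s') c else x.

(** Probability of the next letter when the bandit is at t. Each letter records the
    reward of the played arm alone, hence the marginals pA and pB. *)
Definition law (t : R) (c : bool * bool) : R :=
  (if c.1 then t else 1 - t) *
  (let p := if c.1 then pA else pB in if c.2 then p else 1 - p).

Definition step (f : word -> R) (s : word) : R :=
  law (pos s) (true, true) * f ((true, true) :: s) +
  law (pos s) (true, false) * f ((true, false) :: s) +
  law (pos s) (false, true) * f ((false, true) :: s) +
  law (pos s) (false, false) * f ((false, false) :: s).

(** Expectation of f after m further steps, given the history s. *)
Fixpoint mean (m : nat) (f : word -> R) (s : word) : R :=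
  if m is m'.+1 then step (mean m' f) s else f s.

(** The bounds are imposed only from time n0 on, where the hypotheses on gamma
    and eps become effective. *)
Definition supermartingale (n0 : nat) (f : word -> R) : Prop :=
  forall s, (n0 <= size s)%N -> 0 <= f s /\ step f s <= f s.

Hypotheses (hpA : 0 < pA < 1) (hpB : 0 < pB < 1) (hx : 0 < x < 1).
Hypothesis hgamma : forall n, (0 < n)%N -> 0 < gamma n < 1.

Lemma pos_in01 s : 0 < pos s < 1.
Proof.
elim: s => [//|[u b] s IH] /=; rewrite /jump /=.
have := hgamma (ltn0Sn (size s)); set g := gamma _; move: IH; set t := pos s.
move=> /andP[t0 t1] /andP[g0 g1].
have h1 : 0 < g * (1 - t) by apply: mulr_gt0; lra.
have h2 : 0 < g * t by apply: mulr_gt0; lra.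
have h3 : 0 < (1 - g) * (1 - t) by apply: mulr_gt0; lra.
have h4 : 0 < (1 - g) * t by apply: mulr_gt0; lra.
by case: u b => [] [] /=;
  rewrite ?mul1r ?mul0r ?subr0 ?sub0r ?addr0 ?mulr0 ?mulrN;
  apply/andP; split; lra.
Qed.

Lemma pos_up s : pos ((true, true) :: s) = pos s + gamma (size s).+1 * (1 - pos s).
Proof. by rewrite /= /jump /= mul1r mul0r subr0. Qed.

Lemma pos_down s : pos ((false, true) :: s) = pos s - gamma (size s).+1 * pos s.
Proof. by rewrite /= /jump /= mul0r mul1r sub0r mulrN. Qed.

Lemma pos_stay u s : pos ((u, false) :: s) = pos s.
Proof. by rewrite /= /jump /= andbF andbF !mul0r subr0 mulr0 addr0. Qed.

Lemma law_ge0 s c : 0 <= law (pos s) c.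
Proof.
have /andP[t0 t1] := pos_in01 s.
have /andP[? ?] := hpA; have /andP[? ?] := hpB.
by case: c => [[] []]; rewrite /law /=; apply: mulr_ge0; lra.
Qed.

Lemma le_step f g s : (forall c, f (c :: s) <= g (c :: s)) ->
  step f s <= step g s.
Proof.
move=> fg; rewrite /step.
by do 3 (apply: lerD; last by apply: ler_wpM2l; [exact: law_ge0|exact: fg]);
  apply: ler_wpM2l; [exact: law_ge0|exact: fg].
Qed.

Lemma eq_step f g s : (forall c, f (c :: s) = g (c :: s)) ->
  step f s = step g s.
Proof. by move=> fg; rewrite /step !fg. Qed.

Lemma step_cst k s : step (fun=> k) s = k.
Proof. by rewrite /step /law /=; ring. Qed.

Lemma step_affine a k f s : step (fun u => a * f u + k) s = a * step f s + k.
Proof. by rewrite /step /law /=; ring. Qed.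

Lemma le_mean m f g s : (forall u, size u = (m + size s)%N -> f u <= g u) ->
  mean m f s <= mean m g s.
Proof.
elim: m s => [|m IH] s fg /=; first exact: fg.
by apply: le_step => c; apply: IH => u us; apply: fg; rewrite us addSnnS.
Qed.

Lemma mean_super n0 f m s : supermartingale n0 f -> (n0 <= size s)%N ->
  mean m f s <= f s.
Proof.
move=> sf; elim: m s => [//|m IH] s hs /=.
apply: le_trans (sf s hs).2; apply: le_step => c.
by apply: IH; exact: leq_trans hs _.
Qed.

Lemma mean_super_start n0 f z k m s : supermartingale n0 f ->
  (forall u, size u = n0 -> f u <= z) -> (k + size s = n0)%N ->
  mean (k + m) f s <= z.
Proof.
move=> sf fz; elim: k s => [|k IH] s hs.
  by apply: le_trans (mean_super m sf _) (fz _ _); rewrite -hs.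
rewrite addSn /= -(step_cst z s); apply: le_step => c.
by apply: IH; rewrite /= addnS -addSn.
Qed.

(** There are finitely many histories of each length, so that every process is
    bounded at a fixed time. *)
Lemma bounded_on_size (f : word -> R) n :
  exists C, 0 < C /\ forall s, size s = n -> f s <= C.
Proof.
elim: n f => [|n IH] f.
  exists (`|f [::]| + 1); split; first by rewrite ltr_wpDl.
  by move=> [|//] _; rewrite (le_trans (ler_norm _))// lerDl.
have [C [C0 CP]] := IH (fun s => `|f ((true, true) :: s)| +
  `|f ((true, false) :: s)| + `|f ((false, true) :: s)| +
  `|f ((false, false) :: s)|).
exists C; split => // -[//|c s] [/CP]; apply: le_trans.
move: (f) => h; apply: le_trans (ler_norm _) _.
have h0 u : 0 <= `|h (u :: s)| by [].
have := (h0 (true, true), h0 (true, false), h0 (false, true), h0 (false, false)).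
by move=> [[[? ?] ?] ?]; case: c => [[] []]; lra.
Qed.

(** * Stopping supermartingales *)

(** The process M, frozen at the first time from n0 on when it exceeds lam. *)
Section freeze.
Context (n0 : nat) (M : word -> R) (lam : R).
Fixpoint freeze (s : word) : R :=
  if s is c :: s' then
    if (n0 <= size s')%N && (lam < freeze s') then freeze s' else M s
  else M s.

Lemma freeze_small s : freeze s <= lam -> freeze s = M s.
Proof.
by case: s => [//|c s] /=; case: ifP => // /andP[_]; rewrite ltNge => /negbTE ->.
Qed.

Lemma freeze_start s : size s = n0 -> freeze s = M s.
Proof. by case: s => [//|c s] /= <-; rewrite ltnn. Qed.

Lemma freeze_super : supermartingale n0 M -> supermartingale n0 freeze.
Proof.
move=> sM s hs; split.
  elim: s hs => [|c s IH] hs /=; first by have [] := sM _ hs.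
  by case: ifPn => [/andP[/IH]//|_]; have [] := sM _ hs.
have [big|small] := ltP lam (freeze s).
  rewrite (eq_step (g := fun=> freeze s)) ?step_cst// => c.
  by rewrite /= hs big.
rewrite (freeze_small small); apply: le_trans (sM s hs).2.
by rewrite (eq_step (g := M))// => c; rewrite /= hs ltNge small.
Qed.

Lemma freeze_hit s : (lam < M s) -> lam < freeze s.
Proof. by case: s => [//|c s] /=; case: ifP => // /andP[]. Qed.

Lemma freeze_stays c s : (n0 <= size s)%N -> lam < freeze s -> lam < freeze (c :: s).
Proof. by move=> hs h /=; rewrite hs h. Qed.
End freeze.

(** The compensated process f_n + g_n0 + ... + g_(n-1), stopped at the first time
    when ok fails. It is a nonnegative supermartingale as soon as g is at most the
    expected decrease of f wherever ok holds; f itself only has to be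
    nonnegative up to the stopping time included, which is why positivity is
    asked one step after ok. *)
Section stopped.
Context (n0 : nat) (ok : word -> bool) (f g : word -> R).

Fixpoint alive (s : word) : bool :=
  if s is c :: s' then ((size s' < n0)%N || alive s') && ok s else ok s.

Fixpoint stopped (s : word) : R :=
  if s is c :: s' then
    if (n0 <= size s')%N then
      if alive s' then stopped s' - f s' + g s' + f s else stopped s'
    else f s
  else f s.

Lemma alive_ok s : alive s -> ok s.
Proof. by case: s => [//|c s] /andP[]. Qed.

Hypothesis g_ge0 : forall s, 0 <= g s.
Hypothesis f_start : forall s, size s = n0 -> 0 <= f s.
Hypothesis f_next : forall c s, (n0 <= size s)%N -> ok s -> 0 <= f (c :: s).
Hypothesis f_step : forall s, (n0 <= size s)%N -> ok s -> step f s + g s <= f s.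

Lemma stopped_ge s : (n0 <= size s)%N -> alive s -> f s <= stopped s.
Proof.
elim: s => [//|c s IH] hs /= /andP[+ oks].
case: ltnP => //= hs' als; rewrite als -[leLHS]add0r lerD// addr_ge0// subr_ge0.
exact: IH.
Qed.

Lemma stopped_super : supermartingale n0 stopped.
Proof.
move=> s hs; split.
  elim: s hs => [hs|c s IH hs] /=; first by apply: f_start; case: (n0) hs.
  case: ifPn => [hs'|]; last first.
    by rewrite -ltnNge => hs'; apply: f_start; apply/eqP; rewrite eqn_leq hs'.
  case: ifPn => [als|_]; last exact: IH.
  by rewrite addr_ge0 ?f_next ?alive_ok// addr_ge0// subr_ge0 stopped_ge.
have [als|nals] := boolP (alive s).
  rewrite (eq_step (g := fun u => 1 * f u + (stopped s - f s + g s))).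
    by rewrite step_affine; have := f_step hs (alive_ok als); lra.
  by move=> c; rewrite /= hs als; ring.
rewrite (eq_step (g := fun=> stopped s)) ?step_cst// => c.
by rewrite /= hs (negbTE nals).
Qed.
End stopped.
End chain.

(** * Potentials for the ratio (1 - X) / gamma *)

Section potentials.
Context (R : realType) (pA pB x : R) (gamma : nat -> R).
Hypotheses (hpB : 0 < pB) (hpBA : pB < pA) (hpA : pA < 1) (hx : 0 < x < 1).
Hypothesis hgamma : forall n, (0 < n)%N -> 0 < gamma n < 1.
Local Notation pi := (pA - pB).
Local Notation pos := (pos x gamma).
Local Notation step := (step pA pB x gamma).
Local Notation eps := (eps pA pB gamma).
Local Notation supermartingale := (supermartingale pA pB x gamma).

Let posP s : 0 < pos s /\ pos s < 1.
Proof. by have /andP[] := pos_in01 hx hgamma s. Qed.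

Let gP n : 0 < gamma n.+1 /\ gamma n.+1 < 1.
Proof. by have /andP[] := hgamma (ltn0Sn n). Qed.

Let hA : 0 < pA < 1. Proof. by rewrite (lt_trans hpB hpBA) hpA. Qed.
Let hB : 0 < pB < 1. Proof. by rewrite hpB (lt_trans hpBA hpA). Qed.

Let armP : [/\ 0 < pB, pB < pA & pA < 1]. Proof. by []. Qed.

Lemma step_1Bpos s : step (fun u => 1 - pos u) s =
  (1 - pos s) * (1 - gamma (size s).+1 * pi * pos s).
Proof. by rewrite /step pos_up pos_down !pos_stay /law /=; ring. Qed.

Lemma step_1Bpos_sqr s : step (fun u => (1 - pos u) ^+ 2) s =
  ((1 - pos s) * (1 - gamma (size s).+1 * pi * pos s)) ^+ 2 +
  gamma (size s).+1 ^+ 2 * (pos s * (1 - pos s) *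
    (pA * (1 - pos s) + pB * pos s - pi ^+ 2 * pos s * (1 - pos s))).
Proof. by rewrite /step pos_up pos_down !pos_stay /law /=; ring. Qed.

Lemma pos_increment s c : 1 - pos (c :: s) <= 1 - pos s + gamma (size s).+1.
Proof.
have [t0 t1] := posP s; have [g0 g1] := gP (size s).
have h1 : 0 <= gamma (size s).+1 * (1 - pos s) by apply: mulr_ge0; lra.
have h2 : 0 <= gamma (size s).+1 * pos s by apply: mulr_ge0; lra.
by case: c => [[] []]; rewrite ?pos_up ?pos_down ?pos_stay; lra.
Qed.

(** The central quantity V_n = (1 - X_n) / gamma_n. A success of the second arm adds
    X_n to (1 - X_n) / gamma_(n+1), so that a move away from 1 shows up in V at scale
    1, whatever the step size. *)
Definition ratio s : R := (1 - pos s) / gamma (size s).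

Lemma ratio_gt0 s : (0 < size s)%N -> 0 < ratio s.
Proof.
move=> s0; apply: divr_gt0; first by have [] := posP s; lra.
by have /andP[] := hgamma s0.
Qed.

(** This is where eps comes from: replacing gamma_n by gamma_(n+1) multiplies 1 - X_n
    by an additional eps_n + pi, and the drift of X removes pi X_n (1 - X_n). *)
Lemma step_ratio s : (0 < size s)%N ->
  step ratio s = ratio s + (1 - pos s) * (eps (size s) + pi * (1 - pos s)).
Proof.
move=> s0; have /andP[g0 _] := hgamma s0; have [g'0 _] := gP (size s).
rewrite (@eq_step _ pA pB x gamma _
  (fun u => (gamma (size s).+1)^-1 * (1 - pos u) + 0)); last first.
  by move=> c; rewrite /ratio addr0 mulrC.
rewrite step_affine step_1Bpos /ratio /eps addr0.
by field; rewrite !gt_eqF.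
Qed.

Lemma step_ratio_sqr s : step (fun u => ratio u ^+ 2) s =
  (step ratio s) ^+ 2 + (pos s * (1 - pos s) *
    (pA * (1 - pos s) + pB * pos s - pi ^+ 2 * pos s * (1 - pos s))).
Proof.
have [g'0 _] := gP (size s).
rewrite (@eq_step _ pA pB x gamma (fun u => ratio u ^+ 2)
  (fun u => (gamma (size s).+1)^-1 ^+ 2 * (1 - pos u) ^+ 2 + 0)); last first.
  by move=> c; rewrite /ratio addr0 exprMn mulrC.
rewrite (@eq_step _ pA pB x gamma ratio
  (fun u => (gamma (size s).+1)^-1 * (1 - pos u) + 0)); last first.
  by move=> c; rewrite /ratio addr0 mulrC.
rewrite !step_affine step_1Bpos_sqr step_1Bpos.
by field; rewrite gt_eqF.
Qed.

(** Sum of g over the strict past, so that past g is known one step ahead. *)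
Fixpoint past (g : word -> R) (s : word) : R :=
  if s is c :: s' then past g s' + g s' else 0.

(** Bound on the expected relative growth of the ratio. It is set to 0 on the
    empty history, because gamma 0 and eps 0 are arbitrary. *)
Definition load s : R :=
  if s is [::] then 0 else
  gamma (size s) * Num.max (eps (size s)) 0 + pi * gamma (size s) * (1 - pos s).

Lemma load_ge0 s : 0 <= load s.
Proof.
have [pB0 pBA pA1] := armP.
case: s => [//|c s]; have [] := gP (size s); have [] := posP (c :: s) => *.
by apply: addr_ge0; apply: mulr_ge0; rewrite ?le_max ?lexx ?orbT ?mulr_ge0//; lra.
Qed.

Lemma past_ge0 g s : (forall u, 0 <= g u) -> 0 <= past g s.
Proof. by move=> g0; elim: s => //= c s IH; apply: addr_ge0. Qed.

Lemma drift_le_load s : (0 < size s)%N ->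
  (1 - pos s) * (eps (size s) + pi * (1 - pos s)) <= ratio s * load s.
Proof.
have [pB0 pBA pA1] := armP.
move=> s0; have /andP[g0 _] := hgamma s0; have [t0 t1] := posP s.
have -> : ratio s * load s =
    (1 - pos s) * (Num.max (eps (size s)) 0 + pi * (1 - pos s)).
  case: s s0 g0 t0 t1 => // c s s0 g0 t0 t1.
  by rewrite /ratio /load; field; rewrite gt_eqF.
by apply: ler_wpM2l; [lra|rewrite lerD2r le_max lexx].
Qed.

(** By concavity ln (1 + V) grows in mean by at most the relative growth of V. The
    sum of the loads is subtracted from a constant K rather than added, so that the
    potential stays nonnegative as long as that sum is at most K. *)
Lemma log_ratio_drift K s : (0 < size s)%N ->
  step (fun u => ln (1 + ratio u) + (K - past load u)) s + 0 <=
  ln (1 + ratio s) + (K - past load s).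
Proof.
have [pB0 pBA pA1] := armP.
move=> s0; have V0 := ratio_gt0 s0; rewrite addr0.
set k := K - (past load s + load s) - ratio s / (1 + ratio s) + ln (1 + ratio s).
apply: (@le_trans _ _ (step (fun u => (1 + ratio s)^-1 * ratio u + k) s)).
  apply: (le_step hA hB hx hgamma) => c; rewrite /k [past _ _]/=.
  have V1 := @ratio_gt0 (c :: s) isT; set V' := ratio (c :: s) in V1 *.
  have -> : 1 + V' = (1 + ratio s) * (1 + (V' - ratio s) / (1 + ratio s)).
    by field; lra.
  have q0 : -1 < (V' - ratio s) / (1 + ratio s).
    by rewrite ltr_pdivlMr; lra.
  rewrite lnM ?posrE; [|lra|lra].
  by have := le_ln1Dx q0; move: (1 + ratio s)^-1 => iv; lra.
rewrite step_affine step_ratio//.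
have := drift_le_load s0; set D := (1 - _) * _ => Dle.
have : D / (1 + ratio s) <= load s.
  rewrite ler_pdivrMr; last lra.
  by have := load_ge0 s; lra.
rewrite /k; move: (1 + ratio s)^-1 => iv; lra.
Qed.

(** A bound on the loads also bounds gamma_n eps_n, hence gamma_n / gamma_(n+1), so that the
    ratio cannot overshoot by much when it first exceeds L. *)
Lemma ratio_next L K s c : (0 < size s)%N -> past load s + load s <= K ->
  ratio s <= L -> ratio (c :: s) <= L * (K + 2) + 1.
Proof.
have [pB0 pBA pA1] := armP.
move=> s0 HK VL; have V0 := ratio_gt0 s0.
have /andP[g0 g1] := hgamma s0; have [g'0 _] := gP (size s).
have [t0 t1] := posP s.
have lK : gamma (size s) * eps (size s) <= K.
  apply: le_trans HK; apply: (@le_trans _ _ (load s)); last first.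
    by rewrite lerDr past_ge0// => u; exact: load_ge0.
  case: s s0 g0 t1 {VL V0 g1 g'0 t0} => // c' s s0 g0 t1; rewrite /load.
  apply: (@le_trans _ _ (gamma (size (c' :: s)) * Num.max (eps (size (c' :: s))) 0)).
    by apply: ler_wpM2l; [exact: ltW|rewrite le_max lexx].
  by rewrite lerDl !mulr_ge0//; lra.
have -> : ratio (c :: s) = (1 - pos (c :: s)) / gamma (size s).+1 by [].
apply: (@le_trans _ _
  (ratio s * (gamma (size s) * eps (size s) + 1 + gamma (size s) * pi) + 1)).
  rewrite ler_pdivrMr//; apply: le_trans (pos_increment s c) _.
  rewrite /ratio /Defs.eps le_eqVlt; apply/orP; left; apply/eqP.
  by field; rewrite !gt_eqF.
rewrite lerD2r; have p1 : gamma (size s) * pi <= 1.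
  by rewrite -[leRHS]mulr1; apply: ler_pM; lra.
have gp0 : 0 <= gamma (size s) * pi by rewrite mulr_ge0//; lra.
have K0 : 0 <= K + 2.
  by have := load_ge0 s; have := past_ge0 s load_ge0; lra.
apply: (@le_trans _ _ (ratio s * (K + 2))); first by apply: ler_wpM2l; lra.
by apply: ler_wpM2r.
Qed.

(** The concave potential 2 K1 V - V^2 loses in mean the conditional variance of
    V, up to a drift term paid by the load. That variance is at least
    pB X^2 (1 - X), the contribution of the successes of the second arm. *)
Lemma ratio_variance K1 L K s : (0 < size s)%N -> past load s + load s <= K ->
  ratio s <= L -> L <= K1 ->
  step (fun u => 2 * K1 * ratio u - ratio u ^+ 2 + 2 * K1 * L * (K - past load u)) s
  + pB * pos s ^+ 2 * (1 - pos s) <=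
  2 * K1 * ratio s - ratio s ^+ 2 + 2 * K1 * L * (K - past load s).
Proof.
have [pB0 pBA pA1] := armP.
move=> s0 HK VL LK; have V0 := ratio_gt0 s0; have [t0 t1] := posP s.
(* E V'^2 is the variance plus the square of the mean V + D; expanding it leaves
   2 (K1 - V) D - D^2 minus the variance, and V <= L <= K1 bounds the first term. *)
rewrite (_ : step _ s = 2 * K1 * step ratio s - step (fun u => ratio u ^+ 2) s
  + 2 * K1 * L * (K - (past load s + load s))); last first.
  by rewrite /step /law [past _ (_ :: _)]/= /=; ring.
rewrite step_ratio_sqr step_ratio//.
have := drift_le_load s0; set D := (1 - _) * (_ + _) => Dle.
have l0 := load_ge0 s.
have DL : D <= L * load s by apply: le_trans Dle _; apply: ler_wpM2r.
have KD : (K1 - ratio s) * D <= K1 * (L * load s).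
  have [D0|D0] := lerP 0 D; first by apply: ler_pM; lra.
  apply: (@le_trans _ _ 0); last by rewrite !mulr_ge0//; lra.
  by apply: mulr_ge0_le0; lra.
have var : pB * pos s ^+ 2 * (1 - pos s) <= pos s * (1 - pos s) *
    (pA * (1 - pos s) + pB * pos s - pi ^+ 2 * pos s * (1 - pos s)).
  rewrite (_ : pB * _ * _ = pos s * (1 - pos s) * (pB * pos s)); last by ring.
  apply: ler_wpM2l; first by apply: mulr_ge0; lra.
  suff : pi ^+ 2 * pos s * (1 - pos s) <= pA * (1 - pos s) by lra.
  apply: ler_wpM2r; first lra.
  have : pi ^+ 2 * pos s <= pi.
    rewrite -[leRHS]mulr1 expr2 -mulrA; apply: ler_wpM2l; first lra.
    by rewrite -[leRHS]mulr1; apply: ler_pM; lra.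
  by lra.
have D2 : 0 <= D ^+ 2 by exact: sqr_ge0.
set v := pos s * _ * _ in var *.
rewrite (_ : (ratio s + D) ^+ 2 = ratio s ^+ 2 + 2 * (ratio s * D) + D ^+ 2);
  last by ring.
have -> : 2 * K1 * (ratio s + D) =
  2 * K1 * ratio s + 2 * ((K1 - ratio s) * D) + 2 * (ratio s * D).
  by ring.
have -> : 2 * K1 * L * (K - (past load s + load s)) =
  2 * K1 * L * (K - past load s) - 2 * (K1 * (L * load s)) by ring.
lra.
Qed.

(** * The martingale Y when eps is bounded below *)

Section tail.
Context (c : R) (n0 : nat).
Hypothesis c0 : 0 < c.
Hypothesis n0_gt0 : (0 < n0)%N.
Hypothesis epsc : forall n, (n0 <= n)%N -> c <= eps n.

(** The same ratio with the next step size: unlike the ratio it controls the size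
    of the next value of V, even if gamma drops suddenly. *)
Definition next_ratio s : R := (1 - pos s) / gamma (size s).+1.

Lemma ratio_next_le s b : ratio (b :: s) <= next_ratio s + 1.
Proof.
have [g0 _] := gP (size s).
rewrite /ratio ler_pdivrMr// [size _]/=; apply: le_trans (pos_increment s b) _.
by rewrite /next_ratio mulrDl divfK ?gt_eqF// mul1r.
Qed.

(** When eps is at least c the ratio increases in mean by c (1 - X), so a
    bounded ratio makes the sum of 1 - X finite. *)
Lemma ratio_drift_ge k s : (n0 <= size s)%N ->
  step (fun u => k - ratio u) s + c * (1 - pos s) <= k - ratio s.
Proof.
move=> hs; have [pB0 pBA pA1] := armP; have [t0 t1] := posP s.
rewrite (@eq_step _ pA pB x gamma _ (fun u => -1 * ratio u + k)); last first.
  by move=> b; rewrite mulN1r addrC.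
rewrite step_affine step_ratio ?(leq_trans n0_gt0)//.
have e : c * (1 - pos s) <= (1 - pos s) * eps (size s).
  by rewrite mulrC; apply: ler_wpM2l; [lra|exact: epsc].
have e2 : 0 <= (1 - pos s) * (pi * (1 - pos s)) by rewrite !mulr_ge0//; lra.
by rewrite mulrDr; lra.
Qed.

Fixpoint theta_word s : R :=
  if s is _ :: s' then theta_word s' * (1 - gamma (size s) * pi * pos s') else 1.

Definition Y_word s : R := (1 - pos s) / theta_word s.

Definition theta_next s : R := theta_word s * (1 - gamma (size s).+1 * pi * pos s).

(** The coefficient gamma_(n+1) / theta_(n+1), known at time n since theta_(n+1)
    only involves X_0, ..., X_n. *)
Definition beta s : R := gamma (size s).+1 / theta_next s.

Lemma factor_bounds s : 1 - pi < 1 - gamma (size s).+1 * pi * pos s.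
Proof.
have [pB0 pBA pA1] := armP; have [t0 t1] := posP s; have [g0 g1] := gP (size s).
rewrite ltrD2l ltrN2 (mulrAC _ pi).
have h : gamma (size s).+1 * pos s < 1.
  by rewrite -[ltRHS]mulr1; apply: ltr_pM; lra.
by rewrite -[ltRHS]mul1r ltr_pM2r//; lra.
Qed.

Lemma theta_word_gt0 s : 0 < theta_word s.
Proof.
have [pB0 pBA pA1] := armP.
by elim: s => //= b s IH; rewrite mulr_gt0//; have := factor_bounds s; lra.
Qed.

Lemma theta_next_gt0 s : 0 < theta_next s.
Proof. exact: (theta_word_gt0 ((true, true) :: s)). Qed.

Lemma Y_word_gt0 s : 0 < Y_word s.
Proof. by rewrite divr_gt0 ?theta_word_gt0//; have [] := posP s; lra. Qed.

Lemma beta_gt0 s : 0 < beta s.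
Proof. by rewrite divr_gt0 ?theta_next_gt0//; have [] := gP (size s). Qed.

Lemma step_Y_word s : step Y_word s = Y_word s.
Proof.
have [pB0 pBA pA1] := armP.
have th0 := theta_word_gt0 s; have fb := factor_bounds s.
rewrite (@eq_step _ pA pB x gamma Y_word
  (fun u => (theta_next s)^-1 * (1 - pos u) + 0)); last first.
  by move=> b; rewrite addr0 mulrC.
rewrite step_affine step_1Bpos /theta_next /Y_word addr0; field.
by rewrite gt_eqF//= gt_eqF//; lra.
Qed.

(** The variance of one step of Y is at most (gamma / theta)^2 (1 - X), which is
    Y times gamma beta up to the constant 1 / (1 - pi) coming from
    theta_n / theta_(n+1). *)
Lemma Y_word_second_moment y s : step (fun u => (Y_word u - y) ^+ 2) s <=
  (Y_word s - y) ^+ 2 + (1 - pi)^-1 * gamma (size s).+1 * Y_word s * beta s.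
Proof.
have [pB0 pBA pA1] := armP; have [t0 t1] := posP s; have [g0 g1] := gP (size s).
have th0 := theta_word_gt0 s; have fb := factor_bounds s; have tn0 := theta_next_gt0 s.
pose k := (theta_next s)^-1.
rewrite (_ : step _ s = k ^+ 2 * step (fun u => (1 - pos u) ^+ 2) s
   - 2 * y * k * step (fun u => 1 - pos u) s + y ^+ 2); last first.
  by rewrite /step /law /Y_word /= -/(theta_next s) -/k; ring.
rewrite step_1Bpos_sqr step_1Bpos.
have -> : (1 - pos s) * (1 - gamma (size s).+1 * pi * pos s) = Y_word s * theta_next s.
  by rewrite /Y_word /theta_next; field; rewrite gt_eqF.
set g := gamma (size s).+1 in g0 g1 fb *; set t := pos s in t0 t1 fb *.
set bra := t * (1 - t) * _.
rewrite (_ : k ^+ 2 * _ - _ + _ = (Y_word s - y) ^+ 2 + (k * g) ^+ 2 * bra); last first.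
  by rewrite /k; field; rewrite gt_eqF.
rewrite lerD2l; apply: (@le_trans _ _ ((k * g) ^+ 2 * (1 - t))).
  apply: ler_wpM2l; first exact: sqr_ge0.
  rewrite /bra mulrAC -[leRHS]mul1r; apply: ler_wpM2r; first lra.
  have q1 : 0 <= pi ^+ 2 * t * (1 - t) by rewrite !mulr_ge0//; lra.
  have q2 : pi ^+ 2 * t * (1 - t) <= pA * (1 - t).
    apply: ler_wpM2r; first lra.
    have : pi ^+ 2 * t <= pi.
      rewrite -[leRHS]mulr1 expr2 -mulrA; apply: ler_wpM2l; first lra.
      by rewrite -[leRHS]mulr1; apply: ler_pM; lra.
    by lra.
  have q3 : 0 <= pB * t by rewrite mulr_ge0//; lra.
  have q4 : pA * (1 - t) <= 1 - t by rewrite -[leRHS]mul1r; apply: ler_wpM2r; lra.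
  have q5 : pB * t <= t by rewrite -[leRHS]mul1r; apply: ler_wpM2r; lra.
  rewrite -[leRHS]mulr1; apply: ler_pM; [lra|lra|lra|].
  by lra.
have -> : (1 - pi)^-1 * g * Y_word s * beta s =
    (k * g) ^+ 2 * (1 - t) * ((1 - g * pi * t) / (1 - pi)).
  rewrite /Y_word /beta /k /theta_next -/g -/t; field.
  by rewrite !gt_eqF//; lra.
rewrite -[leLHS]mulr1; apply: ler_wpM2l.
  by rewrite mulr_ge0 ?sqr_ge0//; lra.
by rewrite ler_pdivlMr; lra.
Qed.

(** The lower bound on eps makes gamma decrease faster than theta, at relative
    rate c gamma. *)
Lemma beta_next b s : (n0 <= size (b :: s))%N ->
  beta (b :: s) <= beta s * (1 - c * gamma (size s).+2).
Proof.
move=> hs; have [pB0 pBA pA1] := armP.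
have fb := factor_bounds (b :: s); have tn0 := theta_next_gt0 s.
have [t0 t1] := posP (b :: s); have [g0 g1] := gP (size s).
have [g'0 g'1] := gP (size s).+1.
have := epsc hs; rewrite /Defs.eps [size _]/= => e.
have -> : beta (b :: s) = gamma (size s).+2 /
  (theta_next s * (1 - gamma (size s).+2 * pi * pos (b :: s))) by [].
rewrite [size _]/= in fb.
set g := gamma (size s).+1 in g0 g1 e *; set g' := gamma (size s).+2 in g'0 g'1 e fb *.
set t := pos (b :: s) in t0 t1 fb *.
have gg : g' <= g * (1 - g' * (pi + c)).
  have : g * g' * (c + pi) <= g * g' * (g'^-1 - g^-1).
    by apply: ler_wpM2l; [rewrite mulr_ge0// ltW|lra].
  have -> : g * g' * (g'^-1 - g^-1) = g - g' by field; rewrite !gt_eqF.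
  by lra.
rewrite /beta -/g ler_pdivrMr; last by rewrite mulr_gt0//; lra.
have -> : g / theta_next s * (1 - c * g') * (theta_next s * (1 - g' * pi * t)) =
    g * ((1 - c * g') * (1 - g' * pi * t)) by field; rewrite gt_eqF.
apply: le_trans gg _; apply: ler_wpM2l; first exact: ltW.
have h1 : g' * pi * t <= g' * pi.
  by rewrite -[leRHS]mulr1; apply: ler_wpM2l; [rewrite mulr_ge0//|]; lra.
have cp := c0; have h2 : 0 <= c * g' * (g' * pi * t) by rewrite !mulr_ge0//; lra.
by lra.
Qed.

(** Bound on the future quadratic variation of Y: since Y is a martingale and beta
    decreases at rate c gamma, the expected sum of the later gamma Y beta is at
    most Y beta / c. The summand gamma accounts for the current step. *)
Definition noise s : R :=
  (1 - pi)^-1 * Y_word s * ((gamma (size s).+1 + c^-1) * beta s).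

Lemma noise_ge0 s : 0 <= noise s.
Proof.
have [pB0 pBA pA1] := armP; have [g0 _] := gP (size s).
have ci : 0 < c^-1 by rewrite invr_gt0.
have pi0 : 0 < (1 - pi)^-1 by rewrite invr_gt0; lra.
have Y0 := ltW (Y_word_gt0 s); have b0 := ltW (beta_gt0 s).
by apply: mulr_ge0; apply: mulr_ge0 => //; lra.
Qed.

Lemma step_noise s : (n0 <= size s)%N ->
  step noise s <= (1 - pi)^-1 * Y_word s * (c^-1 * beta s).
Proof.
move=> hs; have [pB0 pBA pA1] := armP.
have pi0 : 0 < (1 - pi)^-1 by rewrite invr_gt0; lra.
have b0 := beta_gt0 s.
apply: (@le_trans _ _ (step (fun u => (1 - pi)^-1 * (c^-1 * beta s) * Y_word u + 0) s)).
  apply: (le_step hA hB hx hgamma) => b.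
  rewrite addr0 /noise mulrAC; apply: ler_wpM2r; first exact/ltW/Y_word_gt0.
  apply: ler_wpM2l; first exact: ltW.
  have [g0 g1] := gP (size s).+1.
  have ci : 0 < c^-1 by rewrite invr_gt0.
  apply: (@le_trans _ _
    ((gamma (size s).+2 + c^-1) * (beta s * (1 - c * gamma (size s).+2)))).
    by apply: ler_wpM2l; [lra|apply: beta_next; exact: leqW].
  have -> : (gamma (size s).+2 + c^-1) * (beta s * (1 - c * gamma (size s).+2)) =
    c^-1 * beta s - beta s * (c * gamma (size s).+2 ^+ 2) by field; rewrite gt_eqF.
  have : 0 <= beta s * (c * gamma (size s).+2 ^+ 2).
    by rewrite mulr_ge0 ?(ltW b0)// mulr_ge0 ?sqr_ge0 ?(ltW c0).
  by lra.
by rewrite step_affine step_Y_word addr0 mulrAC.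
Qed.

Section crossing.
Context (K : R).
Hypothesis K0 : 0 < K.

(** The value of Y at the first time from n0 on when (1 - X_n) / gamma_(n+1)
    exceeds K, if that time has come. *)
Fixpoint mark s : option R :=
  let here := if K < next_ratio s then Some (Y_word s) else None in
  if s is b :: s' then
    if (n0 <= size s')%N then if mark s' is Some y then Some y else here
    else here
  else here.

(** A supermartingale that dominates the probability that, at a later time, Y is
    at most half of a marked value y: after the mark it is the Chebyshev bound
    4 (Y - y)^2 / y^2 with a bound of the future variation added; before the mark it
    is an upper bound for the value taken at the marking time. *)
Definition halving s : R :=
  if mark s is Some y then 4 / y ^+ 2 * ((Y_word s - y) ^+ 2 + noise s)
  else 4 * (1 - pi)^-1 ^+ 2 * (1 + c^-1) / K.

Lemma mark_gt0 s y : mark s = Some y -> 0 < y.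
Proof.
have here u : (if K < next_ratio u then Some (Y_word u) else None) = Some y -> 0 < y.
  by case: ifP => // _ [<-]; exact: Y_word_gt0.
elim: s => [|b s IH]; first exact: here.
rewrite /=; case: ifP => _; last exact: (here (b :: s)).
by case: (mark s) IH => [z //|_]; exact: (here (b :: s)).
Qed.

Lemma halving_ge0 s : 0 <= halving s.
Proof.
have [pB0 pBA pA1] := armP; have Kp := K0; have cp := c0.
have ci : 0 < c^-1 by rewrite invr_gt0.
have pi0 : 0 < (1 - pi)^-1 by rewrite invr_gt0; lra.
rewrite /halving; case E: (mark s) => [y|].
  have y0 := mark_gt0 E.
  by rewrite mulr_ge0 ?divr_ge0 ?sqr_ge0// addr_ge0 ?sqr_ge0 ?noise_ge0.
by rewrite !mulr_ge0 ?invr_ge0 ?sqr_ge0//; lra.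
Qed.

(** At the mark the bound is 4 noise / Y^2, and beta / Y is the inverse of the
    ratio up to the factor 1 / (1 - pi); hence the order 1 / K. *)
Lemma halving_at_mark s : K < next_ratio s ->
  4 / Y_word s ^+ 2 * ((Y_word s - Y_word s) ^+ 2 + noise s) <=
  4 * (1 - pi)^-1 ^+ 2 * (1 + c^-1) / K.
Proof.
move=> hK; have [pB0 pBA pA1] := armP; have Kp := K0; have cp := c0.
have fb := factor_bounds s.
have [t0 t1] := posP s; have [g0 g1] := gP (size s).
have th0 := theta_word_gt0 s; have l0 : 0 < next_ratio s by exact: lt_trans hK.
have ci : 0 < c^-1 by rewrite invr_gt0.
have pi0 : 0 < (1 - pi)^-1 by rewrite invr_gt0; lra.
have -> : 4 / Y_word s ^+ 2 * ((Y_word s - Y_word s) ^+ 2 + noise s) =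
    4 * (1 - pi)^-1 * (gamma (size s).+1 + c^-1) *
    ((1 - gamma (size s).+1 * pi * pos s)^-1 / next_ratio s).
  rewrite /noise /Y_word /beta /theta_next /next_ratio; field.
  by rewrite !gt_eqF//; lra.
rewrite [leRHS](_ : _ = 4 * (1 - pi)^-1 * (1 + c^-1) * ((1 - pi)^-1 / K)); last first.
  by field; rewrite !gt_eqF//; lra.
have i0 : 0 < (1 - gamma (size s).+1 * pi * pos s)^-1 by rewrite invr_gt0; lra.
have i1 : 0 < (next_ratio s)^-1 by rewrite invr_gt0.
have i2 : (1 - gamma (size s).+1 * pi * pos s)^-1 <= (1 - pi)^-1.
  by rewrite lef_pV2 ?posrE; lra.
have i3 : (next_ratio s)^-1 <= K^-1 by rewrite lef_pV2 ?posrE// ltW.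
apply: ler_pM.
- by rewrite !mulr_ge0//; lra.
- by rewrite mulr_ge0// ltW.
- by apply: ler_wpM2l; [rewrite mulr_ge0// ltW|lra].
- by apply: ler_pM => //; exact: ltW.
Qed.

Lemma halving_start s : size s = n0 -> halving s <= 4 * (1 - pi)^-1 ^+ 2 * (1 + c^-1) / K.
Proof.
move=> hs; rewrite /halving.
have -> : mark s = if K < next_ratio s then Some (Y_word s) else None.
  by case: s hs => [//|b s] /= <-; rewrite ltnn.
by case: ifP => // /halving_at_mark.
Qed.

Lemma halving_super : supermartingale n0 halving.
Proof.
move=> s hs; split; first exact: halving_ge0.
case E: (mark s) => [y|]; last first.
  rewrite [leRHS]/halving E -[leRHS](step_cst pA pB x gamma _ s).
  apply: (le_step hA hB hx hgamma) => b; rewrite /halving /= hs E.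
  by case: ifP => // hK; exact: halving_at_mark.
have y0 := mark_gt0 E.
pose k := 4 / y ^+ 2; have k0 : 0 <= k by rewrite divr_ge0 ?sqr_ge0.
rewrite (@eq_step _ pA pB x gamma halving
  (fun u => k * ((Y_word u - y) ^+ 2 + noise u) + 0)); last first.
  by move=> b; rewrite /halving /= hs E addr0.
rewrite step_affine addr0 /halving E -/k; apply: ler_wpM2l => //.
rewrite (_ : step _ s = step (fun u => (Y_word u - y) ^+ 2) s + step noise s); last first.
  by rewrite /step; ring.
have := Y_word_second_moment y s; have := step_noise hs; rewrite /noise => h1 h2.
by lra.
Qed.

Lemma mark_hit s : K < next_ratio s -> mark s <> None.
Proof. by case: s => [|b s] /= ->//; case: ifP => //; case: mark. Qed.

Lemma mark_stays b s y : (n0 <= size s)%N -> mark s = Some y -> mark (b :: s) = Some y.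
Proof. by move=> /= -> ->. Qed.

Lemma halving_ge1 s y : mark s = Some y -> Y_word s <= y / 2 -> 1 <= halving s.
Proof.
move=> E hY; rewrite /halving E; have y0 := mark_gt0 E; have Y0 := Y_word_gt0 s.
have n0' := noise_ge0 s.
apply: (@le_trans _ _ (4 / y ^+ 2 * (y / 2) ^+ 2)).
  by rewrite le_eqVlt; apply/orP; left; apply/eqP; field; rewrite gt_eqF.
apply: ler_wpM2l; first by rewrite divr_ge0 ?sqr_ge0.
apply: (@le_trans _ _ ((y - Y_word s) ^+ 2)); first by rewrite ler_sqr ?nnegrE; lra.
by rewrite -sqrrN opprB lerDl.
Qed.
End crossing.
End tail.
End potentials.

(** * Independence along a word *)

Section independence_lemmas.
Context d (T : measurableType d) (R : realType) (P : probability T R).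

(** The list holds one event per time, latest first, which is the shape of the
    events describing a word; hence the index reversal. *)
Lemma independent_seq_cons d' (T' : measurableType d') (Z : nat -> T -> T')
    (E : set T) (l : seq (set T)) (F := fun k => nth setT (E :: l) ((size l).+1 - k)) :
  independent_seq P Z ->
  (forall k, (0 < k <= (size l).+1)%N -> sigma_of (Z k) (F k)) ->
  P (foldr setI setT (E :: l)) = (P E * P (foldr setI setT l))%E.
Proof.
move=> indZ ZF.
pose G l' k := nth setT l' (size l' - k) : set T.
have inI k n : [set` iota 1 n] k <-> (0 < k <= n)%N.
  by rewrite /mkset mem_iota add1n ltnS.
have capE l' : foldr setI setT l' =
    \bigcap_(k in [set` iota 1 (size l')]) G l' k.
  elim: l' => [|D l' IH]; first by rewrite set_nil bigcap_set0.
  rewrite [LHS]/= IH; apply/seteqP; split=> w.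
    move=> [Dw Gw] k /inI /andP[k0]; rewrite leq_eqVlt.
    move=> /orP[/eqP ->|kl]; first by rewrite /G /= subnn.
    by have := Gw k; rewrite /G subSn//; apply; apply/inI; rewrite k0.
  move=> Gw; split.
    have := Gw (size l').+1; rewrite /G subnn; apply.
    by apply/inI; rewrite /= leqnn.
  move=> k /inI /andP[k0 kl]; have := Gw k; rewrite /G subSn//; apply.
  by apply/inI; rewrite k0 /= (leq_trans kl).
have PE n : (n <= (size l).+1)%N ->
    P (\bigcap_(k in [set` iota 1 n]) F k) = (\prod_(k <- iota 1 n) P (F k))%E.
  move=> nl; apply: indZ; rewrite ?iota_uniq// => k; rewrite mem_iota.
    by move=> /andP[].
  by rewrite add1n => /andP[k0 kn]; apply: ZF; rewrite k0 (leq_trans _ nl).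
have := PE (size l).+1 (leqnn _).
have -> : F = G (E :: l) by [].
rewrite -[X in iota 1 X]/(size (E :: l)) -capE => ->.
have -> : iota 1 (size (E :: l)) = rcons (iota 1 (size l)) (size l).+1.
  by rewrite -cats1 -[[:: _]]/(iota (1 + size l) 1) -iotaD addn1.
rewrite big_rcons /= [G _ _.+1]/G/= subnn muleC; congr (_ * _)%E.
rewrite -[G _]/F -PE// capE; congr (P _).
apply: eq_bigcapr => k /inI /andP[k0 kl]; by rewrite /F /G subSn.
Qed.

Lemma sigma_seq_foldr d' (T' : measurableType d') (Z : nat -> T -> T')
    (l : seq (set T)) (F := fun k => nth setT l (size l - k)) :
  (forall k, (0 < k <= size l)%N -> sigma_of (Z k) (F k)) ->
  sigma_seq Z (foldr setI setT l).
Proof.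
rewrite {}/F; elim: l => [|E l IH] ZF.
  exact: (@measurableT _ (g_sigma_algebraType _)).
apply: (@measurableI _ (g_sigma_algebraType _)).
  apply: sub_sigma_algebra; exists (size l).+1 => //=.
  by have := ZF (size l).+1; rewrite /= subnn leqnn; apply.
apply: IH => k /andP[k0 kl]; have := ZF k.
by rewrite /= k0 (leq_trans kl)// subSn//; apply.
Qed.

End independence_lemmas.

Lemma uniform_prob_lower (R : realType) (t : R) : 0 < t < 1 ->
  uniform_prob (@ltr01 R) `]-oo, t] = t%:E.
Proof.
move=> /andP[t0 t1]; rewrite /uniform_prob integral_uniform_pdf.
rewrite (_ : _ `&` _ = `[0, t]%classic); last first.
  apply/seteqP; split=> y /=; rewrite !in_itv /=; first by move=> [-> /andP[-> _]].
  by move=> /andP[-> yt]; split => //; lra.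
rewrite (eq_integral (fun=> 1%:E)); last first.
  move=> y; rewrite inE/= in_itv/= /uniform_pdf => /andP[y0 yt].
  by rewrite y0 (le_trans yt (ltW t1)) subr0 invr1.
by rewrite integral_cst//= lebesgue_measure_itv/= lte_fin t0 mul1e oppr0 adde0.
Qed.

(** * Series with bounded partial sums *)

Section bounded_sums.
Context (R : realType).
Implicit Types (u v : nat -> R).

Lemma nneseries_ltey u m S : (forall n, 0 <= u n) ->
  (forall n, \sum_(0 <= k < n) u k <= S) ->
  (\sum_(m <= n <oo) (u n)%:E < +oo)%E.
Proof.
move=> u0 uS; apply: (@le_lt_trans _ _ S%:E); last exact: ltry.
apply: lime_le; first by apply: is_cvg_nneseries => n _ _; rewrite lee_fin.
apply: nearW => n; rewrite sumEFin lee_fin; apply: le_trans (uS n).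
have [mn|nm] := leqP m n; last by rewrite (big_geq (ltnW nm)) sumr_ge0.
by rewrite (big_cat_nat (leq0n m) mn)/= lerDr sumr_ge0.
Qed.

Lemma nneseries_bounded u m : (forall n, (m <= n)%N -> 0 <= u n) ->
  (\sum_(m <= n <oo) (u n)%:E < +oo)%E ->
  exists S, forall n, \sum_(m <= k < n) u k <= S.
Proof.
move=> u0 fin; set s := (\sum_(m <= n <oo) (u n)%:E)%E in fin.
have s0 : (0 <= s)%E by apply: nneseries_ge0 => n mn _; rewrite lee_fin u0.
exists (fine s) => n; rewrite -lee_fin fineK; last first.
  by rewrite ge0_fin_numE.
rewrite -sumEFin; apply: nneseries_lim_ge => k mk _.
by rewrite lee_fin u0.
Qed.

(** Comparison from rank m on, with a control of v that starts at an unrelated rank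
    j: the finitely many remaining terms only change the bound. *)
Lemma bounded_sum_dominated u v j m S : (forall k, 0 <= v k) ->
  (forall k, (m <= k)%N -> u k <= v k) ->
  (forall n, (j <= n)%N -> \sum_(j <= k < n) v k <= S) ->
  exists S', forall n, \sum_(0 <= k < n) u k <= S'.
Proof.
move=> v0 uv vS; pose M := maxn j m.
have jM : (j <= M)%N by exact: leq_maxl.
have S0 : 0 <= S by have := vS j (leqnn j); rewrite big_geq.
exists (\sum_(0 <= k < M) `|u k| + S) => n.
have [nM|Mn] := leqP n M.
  apply: (@le_trans _ _ (\sum_(0 <= k < n) `|u k|)).
    by apply: ler_sum => k _; exact: ler_norm.
  rewrite [X in _ <= X + _](big_cat_nat (leq0n n) nM)/= -addrA lerDl addr_ge0//.
  by rewrite sumr_ge0.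
rewrite (big_cat_nat (leq0n M) (ltnW Mn))/= lerD//.
  by apply: ler_sum => k _; exact: ler_norm.
apply: le_trans (vS n (leq_trans jM (ltnW Mn))).
rewrite (big_cat_nat jM (ltnW Mn))/=; rewrite ler_wpDl ?sumr_ge0//.
apply: ler_sum_nat => k /andP[Mk _]; apply: uv.
by rewrite (leq_trans _ Mk)// leq_maxr.
Qed.

Lemma limn_einf_gt0 u : (0 < limn_einf (fun n => (u n)%:E))%E ->
  exists c n0, [/\ 0 < c, (0 < n0)%N & forall n, (n0 <= n)%N -> c <= u n].
Proof.
have /cvg_lim limE := @cvg_einfs_sup R (fun n => (u n)%:E).
rewrite limn_einf_lim limE//.
move=> /ereal_sup_gt[_ [m _ <-]] um.
have [c c0 cu] : exists2 c, 0 < c & (c%:E <= einfs (fun n => (u n)%:E) m)%E.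
  case: (einfs _ m) um => [r| |]//; last by exists 1 => //; exact: leey.
  by rewrite lte_fin => r0; exists r.
exists c, m.+1; split => // n mn; rewrite -lee_fin; apply: le_trans cu _.
by apply: ereal_inf_lbound; exists n => //=; exact: ltnW.
Qed.

End bounded_sums.

(** With a_n = gamma_n exp (pi Gamma_n), the bound eps_n >= c gives
    a_(n+1) (1 + c gamma_(n+1)) <= a_n, so that the sum of c gamma_n a_n
    telescopes. *)
Lemma weighted_square_sum (R : realType) (pA pB c : R) (gamma : nat -> R) n0 :
  0 < c -> (0 < n0)%N ->
  (forall n, (0 < n)%N -> 0 < gamma n < 1) ->
  (forall n, (n0 <= n)%N -> c <= eps pA pB gamma n) ->
  (\sum_(1 <= n <oo)
      (gamma n ^+ 2 * expR ((pA - pB) * Gamma gamma n))%:E < +oo)%E.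
Proof.
move=> c0 n0_gt0 hg epsc.
pose a n := gamma n * expR ((pA - pB) * Gamma gamma n).
have a0 n : (0 < n)%N -> 0 < a n.
  by move=> /hg /andP[g0 _]; rewrite mulr_gt0// expR_gt0.
have da n : (n0 <= n)%N -> c * (gamma n.+1 * a n.+1) <= a n - a n.+1.
  move=> nn; have /andP[g0 g1] := hg n (leq_trans n0_gt0 nn).
  have /andP[g'0 g'1] := hg n.+1 isT.
  suff : (1 + c * gamma n.+1) * a n.+1 <= a n by lra.
  have -> : a n = expR (- ((pA - pB) * gamma n.+1)) * (gamma n / gamma n.+1) * a n.+1.
    rewrite /a (_ : Gamma gamma n.+1 = Gamma gamma n + gamma n.+1); last first.
      by rewrite /Gamma big_nat_recr.
    rewrite mulrDr expRD expRN; field.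
    by rewrite !gt_eqF ?expR_gt0.
  apply: ler_wpM2r; first exact/ltW/a0.
  apply: (le_trans (expR_ge1Dx _)).
  have -> : c * gamma n.+1 = - ((pA - pB) * gamma n.+1) + (c + (pA - pB)) * gamma n.+1.
    by ring.
  rewrite expRD; apply: ler_wpM2l; first exact: expR_ge0.
  pose q := 1 - gamma n.+1 / gamma n.
  have qE : (c + (pA - pB)) * gamma n.+1 <= q.
    have := epsc n nn; rewrite /eps => e.
    have -> : q = (((gamma n.+1)^-1 - (gamma n)^-1)) * gamma n.+1.
      by rewrite /q; field; rewrite !gt_eqF.
    by rewrite ler_pM2r//; lra.
  have -> : gamma n / gamma n.+1 = (1 - q)^-1.
    by rewrite (_ : 1 - q = gamma n.+1 / gamma n) ?invf_div// /q; ring.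
  apply: (@le_trans _ _ (expR q)); first by rewrite ler_expR.
  rewrite -[leLHS]invrK -expRN lef_pV2 ?posrE ?expR_gt0//.
    by apply: le_trans (expR_ge1Dx _); lra.
  by rewrite /q opprB addrCA subrr addr0 divr_gt0.
have tel N : (n0 <= N)%N ->
    \sum_(n0.+1 <= k < N.+1) c * (gamma k * a k) <= a n0 - a N.
  elim: N => [|N IH nN]; first by rewrite leqn0 => /eqP E; rewrite E in n0_gt0.
  move: nN; rewrite leq_eqVlt => /orP[/eqP <-|].
    by rewrite big_geq// subrr.
  rewrite ltnS => nN; rewrite big_nat_recr//=.
  by have := IH nN; have := da N nN; lra.
pose u n := gamma n ^+ 2 * expR ((pA - pB) * Gamma gamma n).
have u0 n : 0 <= u n by rewrite mulr_ge0 ?sqr_ge0 ?expR_ge0.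
have [|S uS] := @bounded_sum_dominated R u u n0.+1 0 (a n0 / c) u0 (fun k _ => lexx _).
  case=> [//|N]; rewrite ltnS => nN; rewrite ler_pdivlMr// mulrC mulr_sumr.
  apply: (@le_trans _ _ (a n0 - a N)); last first.
    by have := a0 N (leq_trans n0_gt0 nN); lra.
  apply: le_trans (tel N nN); apply: ler_sum => k _.
  by rewrite /u /a expr2 -!mulrA.
exact: (nneseries_ltey 1 u0 uS).
Qed.

(** * From words to the probability space *)

Section history.
Context d (T : measurableType d) (R : realType) (P : probability T R).
Context (pA pB x : R) (gamma : nat -> R).
Context (U : nat -> {RV P >-> R}) (A B : nat -> set T).
Local Notation pos := (pos x gamma).
Local Notation law := (law pA pB).
Local Notation step := (step pA pB x gamma).
Local Notation mean := (mean pA pB x gamma).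
Local Notation supermartingale := (supermartingale pA pB x gamma).
Local Notation bandit := (bandit x gamma U A B).

Definition arm (u : bool) := if u then A else B.

Fixpoint hist (n : nat) (w : T) : word :=
  if n is m.+1 then
    (U n w <= bandit m w, w \in arm (U n w <= bandit m w) n) :: hist m w
  else [::].

Lemma size_hist n w : size (hist n w) = n.
Proof. by elim: n => //= n ->. Qed.

Lemma bandit_hist n w : bandit n w = pos (hist n w).
Proof.
elim: n => [//|n IH]; rewrite /= /jump size_hist -IH /=.
have indicI (b : T -> bool) D : \1_([set v | b v] `&` D) w = (b w && (w \in D))%:R :> R.
  rewrite indicE in_setI; congr (_%:R); congr (nat_of_bool (_ && _)).
  by apply/idP/idP => [/set_mem//|bw]; apply/mem_set.
rewrite !indicI ltNge /arm.
by case: (U _ w <= _).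
Qed.

Definition choice_event n t (u : bool) : set T :=
  let E := [set w | U n w <= t] in if u then E else ~` E.

Definition reward_event n (c : bool * bool) : set T :=
  if c.2 then arm c.1 n else ~` arm c.1 n.

Fixpoint choice_events (s : word) : seq (set T) :=
  if s is c :: s' then choice_event (size s) (pos s') c.1 :: choice_events s'
  else [::].

Fixpoint reward_events (s : word) : seq (set T) :=
  if s is c :: s' then reward_event (size s) c :: reward_events s' else [::].

(** Given the word, the positions are deterministic, so that the event that the history
    is s splits into conditions on U alone and conditions on (A, B) alone. *)
Lemma hist_event s :
  [set w | hist (size s) w = s] =
  foldr setI setT (reward_events s) `&` foldr setI setT (choice_events s).
Proof.
elim: s => [|[u b] s IH].
  by apply/seteqP; split.
have -> : [set w | hist (size ((u, b) :: s)) w = (u, b) :: s] =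
    [set w | hist (size s) w = s] `&`
    (reward_event (size s).+1 (u, b) `&` choice_event (size s).+1 (pos s) u).
  apply/seteqP; split=> w /=.
    move=> [uE bE hE]; rewrite bandit_hist hE in uE bE; split=> //.
    rewrite uE in bE; split; rewrite /reward_event /choice_event /=.
      by case: (b) bE => bE; [exact: set_mem|by move=> /mem_set; rewrite bE].
    by case: (u) uE => // uE /=; rewrite uE.
  move=> [hE [bE uE]]; rewrite bandit_hist hE.
  have -> : (U (size s).+1 w <= pos s) = u.
    by case: (u) uE => //= uE; apply/negbTE/negP.
  congr ((_, _) :: _); move: bE; rewrite /reward_event /=.
  by case: (b) => bE; [exact: mem_set|exact: memNset].
rewrite IH /=; apply/seteqP; split=> w /=; tauto.
Qed.

Hypothesis (hpA : 0 < pA < 1) (hpB : 0 < pB < 1) (hx : 0 < x < 1).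
Hypothesis hgamma : forall n, (0 < n)%N -> 0 < gamma n < 1.
Hypothesis hUlaw : forall n, (0 < n)%N -> forall S : set R, measurable S ->
     distribution P (U n) S = uniform_prob (@ltr01 R) S.
Hypothesis hUind : independent_seq P (fun n => U n : T -> R).
Hypothesis mA : forall n, (0 < n)%N -> measurable (A n).
Hypothesis mB : forall n, (0 < n)%N -> measurable (B n).
Hypothesis hPA : forall n, (0 < n)%N -> P (A n) = pA%:E.
Hypothesis hPB : forall n, (0 < n)%N -> P (B n) = pB%:E.
Hypothesis hABind : independent_seq P (@indic_pair R T A B).
Hypothesis hABU : independent_classes P (sigma_seq (@indic_pair R T A B))
     (sigma_seq (fun n => U n : T -> R)).

Let mchoice n t u : measurable (choice_event n t u).
Proof.
have mE : measurable [set w | U n w <= t].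
  rewrite -[X in measurable X]setTI.
  have -> : [set w | U n w <= t] = U n @^-1` `]-oo, t].
    by apply/seteqP; split=> w; rewrite /= in_itv.
  exact: measurable_funPT.
by rewrite /choice_event; case: u => //; exact: measurableC.
Qed.

Let mreward n c : (0 < n)%N -> measurable (reward_event n c).
Proof.
move=> n0; rewrite /reward_event /arm; case: c => [[] []] /=;
 do ?[exact: mA|exact: mB]; apply: measurableC; do ?[exact: mA|exact: mB].
Qed.

Let choice_sigma n t u : sigma_of (U n : T -> R) (choice_event n t u).
Proof.
rewrite /choice_event; exists (if u then `]-oo, t]%classic else ~` `]-oo, t]).
  by case: u => //; exact: measurableC.
by rewrite setTI; case: u; apply/seteqP; split=> w; rewrite /= in_itv.
Qed.

Let reward_sigma n c : sigma_of (@indic_pair R T A B n) (reward_event n c).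
Proof.
pose S : set (R * R) := if c.1 then [set 1] `*` setT else setT `*` [set 1].
exists (if c.2 then S else ~` S).
  have mS : measurable S by rewrite /S; case: c.1; exact: measurableX.
  by case: c.2 => //; exact: measurableC.
have SE : @indic_pair R T A B n @^-1` S = arm c.1 n.
  have h (D : set T) w : (\1_D w = 1 :> R) <-> D w.
    rewrite indicE; split=> [|/mem_set -> //].
    by case: (boolP (w \in D)) => [/set_mem//|_ /esym/eqP]; rewrite oner_eq0.
  rewrite /S /arm; case: c.1; apply/seteqP; split=> w /=.
  - by move=> [/h].
  - by move=> /h.
  - by move=> [_ /h].
  - by move=> /h.
by rewrite setTI /reward_event -SE; case: c.2.
Qed.

Let nth_choice s k : (0 < k <= size s)%N ->
  sigma_of (U k : T -> R) (nth setT (choice_events s) (size s - k)).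
Proof.
elim: s => [|c s IH]; first by case: k.
rewrite [size _]/= => /andP[k0]; rewrite leq_eqVlt => /orP[/eqP ->|kl].
  rewrite subnn; exact: choice_sigma.
by rewrite subSn//; apply: IH; rewrite k0.
Qed.

Let nth_reward s k : (0 < k <= size s)%N ->
  sigma_of (@indic_pair R T A B k) (nth setT (reward_events s) (size s - k)).
Proof.
elim: s => [|c s IH]; first by case: k.
rewrite [size _]/= => /andP[k0]; rewrite leq_eqVlt => /orP[/eqP ->|kl].
  rewrite subnn; exact: reward_sigma.
by rewrite subSn//; apply: IH; rewrite k0.
Qed.

Let size_choice s : size (choice_events s) = size s.
Proof. by elim: s => //= c s ->. Qed.

Let size_reward s : size (reward_events s) = size s.
Proof. by elim: s => //= c s ->. Qed.

Let P_choice n t u : (0 < n)%N -> 0 < t < 1 ->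
  P (choice_event n t u) = (if u then t else 1 - t)%:E.
Proof.
move=> n0 t01.
have PE : P (choice_event n t true) = t%:E.
  have -> : choice_event n t true = U n @^-1` `]-oo, t].
    by apply/seteqP; split=> w; rewrite /= in_itv.
  by rewrite -(uniform_prob_lower t01) -(hUlaw n0).
case: u => //; rewrite [choice_event _ _ _]/(~` choice_event n t true).
by rewrite probability_setC// PE.
Qed.

Let P_reward n c : (0 < n)%N -> P (reward_event n c) =
  (let p := if c.1 then pA else pB in if c.2 then p else 1 - p)%:E.
Proof.
move=> n0; rewrite /reward_event /arm.
by case: c => [[] []] /=; rewrite ?probability_setC ?hPA ?hPB//; [exact: mA|exact: mB].
Qed.

(** The conditions on U and on the rewards are independent of each other, and each of
    the two families is independent in time. *)
Lemma P_hist_cons c s :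
  P [set w | hist (size s).+1 w = c :: s] =
  ((law (pos s) c)%:E * P [set w | hist (size s) w = s])%E.
Proof.
have PE u : P [set w | hist (size u) w = u] =
    (P (foldr setI setT (reward_events u)) * P (foldr setI setT (choice_events u)))%E.
  rewrite hist_event hABU//; apply: sigma_seq_foldr => k;
    rewrite ?size_reward ?size_choice; [exact: nth_reward|exact: nth_choice].
rewrite -[(size s).+1]/(size (c :: s)) !PE [reward_events _]/= [choice_events _]/=.
rewrite (independent_seq_cons hABind); last first.
  by rewrite size_reward => k; exact: (@nth_reward (c :: s)).
rewrite (independent_seq_cons hUind); last first.
  by rewrite size_choice => k; exact: (@nth_choice (c :: s)).
rewrite P_choice ?pos_in01// P_reward// /law EFinM.
by rewrite muleACA [X in (X * _)%E]muleC.
Qed.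

Lemma measurable_hist n (Q : set word) : measurable [set w | Q (hist n w)].
Proof.
have -> : [set w | Q (hist n w)] =
    \bigcup_s [set w | [/\ Q s, size s = n & hist (size s) w = s]].
  apply/seteqP; split=> w /=.
    by move=> Qw; exists (hist n w) => //; split; rewrite ?size_hist.
  by move=> [s _ [Qs <- ->]].
apply: countable_bigcupT_measurable => // s.
have [[Qs sn]|nQ] := pselect (Q s /\ size s = n); last first.
  by rewrite (_ : mkset _ = set0)//; apply/seteqP; split=> // w [Qs sn _]; exact: nQ.
have -> : [set w | [/\ Q s, size s = n & hist (size s) w = s]] =
    [set w | hist (size s) w = s].
  by apply/seteqP; split=> w; [case|split].
rewrite hist_event; apply: measurableI.
  elim: (s) => [|c s' IH]; first exact: measurableT.
  by apply: measurableI => //; exact: mreward.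
elim: (s) => [|c s' IH]; first exact: measurableT.
by apply: measurableI.
Qed.

(** The recursive operator mean computes genuine conditional probabilities. *)
Lemma P_hist (Q : word -> bool) m s :
  P [set w | hist (size s) w = s /\ Q (hist (m + size s) w)] =
  (P [set w | hist (size s) w = s] * (mean m (fun u => (Q u)%:R) s)%:E)%E.
Proof.
elim: m s => [|m IH] s.
  rewrite /=; have [Qs|/negbTE Qs] := boolP (Q s).
    rewrite mule1; congr (P _); apply/seteqP; split=> w /=; rewrite add0n; first by case.
    by move=> ->.
  rewrite mule0 -(measure0 P); congr (P _); apply/seteqP; split=> // w /=.
  by rewrite add0n => -[->]; rewrite Qs.
rewrite addSnnS; set N := (m + (size s).+1)%N.
pose E c := [set w | hist (size s).+1 w = c :: s /\ Q (hist N w)].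
have mE c : measurable (E c).
  have -> : E c = [set w | (fun u => u = c :: s) (hist (size s).+1 w)] `&`
     [set w | Q (hist N w)] by [].
  by apply: measurableI;
    [exact: (measurable_hist _ (eq^~ (c :: s)))|exact: (measurable_hist N Q)].
have -> : [set w | hist (size s) w = s /\ Q (hist N w)] =
    ((E (true, true) `|` E (true, false)) `|` E (false, true)) `|` E (false, false).
  rewrite {mE}/E /=; apply/seteqP; split=> w /=.
    move=> [hE QN]; rewrite hE.
    by case: (U _ w <= _); case: (w \in _); tauto.
  by move=> [[[|]|]|] [[_ _ ->] QN].
have disj c c' : c != c' -> E c `&` E c' = set0.
  move=> /eqP cc'; apply/seteqP; split=> // w [[hc _] [hc' _]]; apply: cc'.
  by have [] : c :: s = c' :: s by rewrite -hc -hc'.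
rewrite !measureU;
  [|first [by do ?apply: measurableU | by rewrite ?setIUl !disj ?setU0]..].
have PE c : P (E c) = ((law (pos s) c)%:E * P [set w | hist (size s) w = s] *
    (mean m (fun u => (Q u)%:R) (c :: s))%:E)%E.
  by rewrite -P_hist_cons -[(size s).+1]/(size (c :: s)) -IH.
rewrite -[LHS]/(P (E (true, true)) + P (E (true, false)) + P (E (false, true)) +
  P (E (false, false)))%E !PE /= /step.
have := fin_num_measure P _ (measurable_hist (size s) [set u | u = s]).
move=> /= /fineK <-; rewrite -!EFinM -!EFinD; congr (_%:E); ring.
Qed.

(** * Almost sure consequences of supermartingales *)

Lemma P_super_le n0 f z N : supermartingale n0 f ->
  (forall s, size s = n0 -> f s <= z) -> (n0 <= N)%N ->
  (P [set w | (1 <= f (hist N w))%R] <= z%:E)%E.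
Proof.
move=> sf fz n0N.
have -> : P [set w | (1 <= f (hist N w))%R] = (mean N (fun u => (1 <= f u)%R%:R) [::])%:E.
  have := P_hist (fun u => 1 <= f u) N [::]; rewrite [(N + _)%N]addn0.
  rewrite (_ : mkset (fun w => hist _ w = _) = setT); last by apply/seteqP; split.
  rewrite probability_setT mul1e => <-; congr (P _).
  by apply/seteqP; split=> w /= => [|[]].
rewrite lee_fin.
apply: (@le_trans _ _ (mean N f [::])).
  apply: le_mean => // u; rewrite addn0 => uN; rewrite -uN in n0N.
  by case: (lerP 1 (f u)) => // _; have [] := sf u n0N.
rewrite -(subnKC n0N).
by apply: (mean_super_start hpA hpB hx hgamma _ sf fz); rewrite addn0.
Qed.

(** The bridge from supermartingales on words to null sets: if f starts below z
    and E forces f to be eventually at least 1, then by Markov's inequality at time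
    N and continuity from below E has probability at most z. A family of f, one
    per z, thus makes E negligible without any convergence theorem. *)
Lemma null_event n0 (E : set T) :
  (forall z, 0 < z -> exists f, [/\ supermartingale n0 f,
     forall s, size s = n0 -> f s <= z &
     forall w, E w -> exists m, forall N, (m <= N)%N -> 1 <= f (hist N w)]) ->
  P.-negligible E.
Proof.
move=> H; pose z (j : nat) : R := j.+1%:R^-1.
have z0 j : 0 < z j by rewrite invr_gt0 ltr0n.
pose f j := sval (cid (H _ (z0 j))).
pose S j m := \bigcap_(N in [set N | (m <= N)%N]) [set w | 1 <= f j (hist N w)].
have mS j m : measurable (S j m).
  apply: bigcap_measurable => [|N _]; first by exists m => /=.
  exact: (measurable_hist N (fun u => 1 <= f j u)).
have mSU j : measurable (\bigcup_m S j m) by apply: bigcup_measurable.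
have PS j : (P (\bigcup_m S j m) <= (z j)%:E)%E.
  have [sf fz _] := svalP (cid (H _ (z0 j))).
  have ndB : nondecreasing_seq (S j).
    by move=> m n mn; apply/subsetPset => w Bw N /= nN; apply: Bw; exact: leq_trans nN.
  have cvB := nondecreasing_cvg_mu (mu := P) (mS j) (mSU j) ndB.
  rewrite -(cvg_lim _ cvB)//; apply: lime_le; first by apply/cvg_ex; eexists; exact: cvB.
  apply: nearW => m /=; apply: le_trans (P_super_le sf fz (leq_maxr m n0)).
  apply: le_measure; rewrite ?inE//; last by move=> w; apply => /=; exact: leq_maxl.
  exact: (measurable_hist _ (fun u => 1 <= f j u)).
exists (\bigcap_j \bigcup_m S j m); split.
- by apply: bigcapT_measurable.
- apply/eqP; rewrite -measure_le0; apply/lee_addgt0Pr => e e0; rewrite add0e.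
  have [j _ /(_ j (leqnn j)) ze] := near_infty_natSinv_lt (PosNum e0).
  apply: (@le_trans _ _ (P (\bigcup_m S j m))).
    by apply: le_measure; rewrite ?inE//; [exact: bigcapT_measurable|exact: bigcap_inf].
  by apply: le_trans (PS j) _; rewrite lee_fin ltW.
- move=> w Ew j _; have [_ _ /(_ w Ew)[m Hm]] := svalP (cid (H _ (z0 j))).
  by exists m => // N; exact: Hm.
Qed.

(** Ville's maximal inequality: frozen at the level C / z, where C bounds the initial
    value, and divided by that level, M becomes a test for its own unboundedness. *)
Lemma ville n0 M : supermartingale n0 M ->
  {ae P, forall w, exists l, forall n, (n0 <= n)%N -> M (hist n w) <= l}.
Proof.
move=> sM; apply: (@null_event n0) => z z0.
have [C [C0 CM]] := bounded_on_size M n0.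
pose l := C / z; have l0 : 0 < l by rewrite divr_gt0.
exists (fun s => l^-1 * freeze n0 M l s + 0); split.
- move=> s hs; have [f0 fs] := freeze_super l sM hs.
  rewrite step_affine !addr0; split.
    by rewrite mulr_ge0// invr_ge0 ltW.
  by rewrite ler_wpM2l// invr_ge0 ltW.
- move=> s hs; rewrite addr0 freeze_start// ler_pdivrMl//.
  by rewrite /l divfK ?gt_eqF// CM.
move=> w /= nb; have [n [n0n Ml]] : exists n, (n0 <= n)%N /\ l < M (hist n w).
  apply: contrapT => nex; apply: nb; exists l => n n0n; rewrite leNgt.
  by apply/negP => Ml; apply: nex; exists n.
exists n => N nN; rewrite addr0 ler_pdivlMl// mulr1 ltW//.
rewrite -(subnK nN); elim: (N - n)%N => [|k IH].
  by rewrite add0n; exact: freeze_hit.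
rewrite addSn /=; apply: freeze_stays => //.
by rewrite size_hist (leq_trans n0n)// leq_addl.
Qed.

(** Ville's inequality for the compensated process stopped when ok fails. *)
Lemma lyapunov n0 (ok : word -> bool) (f g : word -> R) :
  (forall s, 0 <= g s) ->
  (forall s, size s = n0 -> 0 <= f s) ->
  (forall c s, (n0 <= size s)%N -> ok s -> 0 <= f (c :: s)) ->
  (forall s, (n0 <= size s)%N -> ok s -> step f s + g s <= f s) ->
  {ae P, forall w, (forall n, (n0 <= n)%N -> ok (hist n w)) ->
    exists l, forall n, (n0 <= n)%N ->
      f (hist n w) <= l /\ \sum_(n0 <= k < n) g (hist k w) <= l}.
Proof.
move=> g0 fs fn fst.
have := ville (stopped_super g0 fs fn fst).
apply: filterS => w [l Hl] okw; exists l => n n0n.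
have sg0 : 0 <= \sum_(n0 <= k < n) g (hist k w) by apply: sumr_ge0 => k _.
have f0 : 0 <= f (hist n w).
  have [nE|] := eqVneq n n0; first by apply: fs; rewrite size_hist.
  case: (n) n0n => [|m]; first by rewrite leqn0 eq_sym => /eqP ->; rewrite eqxx.
  rewrite leq_eqVlt eq_sym => /orP[->//|/=]; rewrite ltnS => n0m _.
  by apply: fn; rewrite ?size_hist// okw.
suff : f (hist n w) + \sum_(n0 <= k < n) g (hist k w) <= l by move=> h; split; lra.
apply: le_trans (Hl n n0n).
have al k : (n0 <= k)%N -> alive n0 ok (hist k w).
  elim: k => [|k IH] n0k; first exact: (okw 0%N).
  rewrite /= size_hist; apply/andP; split; last exact: (okw k.+1).
  by case: ltnP => //= /IH.
elim: n n0n {sg0 f0} => [n0n|n IH].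
  by rewrite big_geq// addr0.
rewrite leq_eqVlt => /orP[/eqP <-|].
  rewrite big_geq// addr0 -{1}(size_hist n0 w).
  by case: (n0) => //= m; rewrite !size_hist ltnn.
rewrite ltnS => n0n; rewrite big_nat_recr//= !size_hist n0n (al n n0n).
by have := IH n0n; set q := hist n.+1 w; lra.
Qed.

(** * The event where X tends to 1 *)

Hypothesis hpBA : pB < pA.
Let pB_gt0 : 0 < pB. Proof. by have /andP[] := hpB. Qed.
Let pA_lt1 : pA < 1. Proof. by have /andP[] := hpA. Qed.
Local Notation pi := (pA - pB).
Local Notation load := (load pA pB x gamma).
Local Notation ratio := (ratio x gamma).
Local Notation next_ratio := (next_ratio x gamma).
Local Notation eps := (eps pA pB gamma).

Let posP s : 0 < pos s /\ pos s < 1.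
Proof. by have /andP[] := pos_in01 hx hgamma s. Qed.

Lemma past_hist (g : word -> R) n w :
  past g (hist n w) = \sum_(0 <= k < n) g (hist k w).
Proof. by elim: n => [|n IH]; [rewrite big_geq|rewrite big_nat_recr//= IH]. Qed.

(** The terms are the expected increments of X, whose sum has expectation at most 1
    because X stays in [0, 1]. *)
Lemma ae_drift_summable : {ae P, forall w, exists l, forall n,
  \sum_(0 <= k < n) pi * gamma k.+1 * (pos (hist k w) * (1 - pos (hist k w))) <= l}.
Proof.
have pip := hpBA.
pose f s : R := 1 - pos s.
pose g s : R := pi * gamma (size s).+1 * (pos s * (1 - pos s)).
have := @lyapunov 0 xpredT f g.
have g0 s : 0 <= g s.
  have [t0 t1] := posP s; have /andP[g0 _] := hgamma (ltn0Sn (size s)).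
  by rewrite /g !mulr_ge0//; lra.
have f0 s : 0 <= f s by have [] := posP s; rewrite /f; lra.
have fg s : step f s + g s <= f s.
  by rewrite /f step_1Bpos /g le_eqVlt; apply/orP; left; apply/eqP; ring.
move=> /(_ g0 (fun s _ => f0 s) (fun c s _ _ => f0 (c :: s)) (fun s _ _ => fg s)).
apply: filterS => w /(_ (fun _ _ => isT))[l Hl]; exists l => n.
apply: le_trans (Hl n (leq0n n)).2; apply: ler_sum => k _.
by rewrite /g size_hist.
Qed.

Lemma ae_ratio_bounded K : 0 <= K ->
  {ae P, forall w,
    (forall n, (0 < n)%N -> past load (hist n w) + load (hist n w) <= K) ->
    exists l, forall n, (0 < n)%N -> ratio (hist n w) <= l}.
Proof.
move=> K0.
pose ok s := past load s + load s <= K.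
pose f s : R := ln (1 + ratio s) + (K - past load s).
have ln0 s : (0 < size s)%N -> 0 <= ln (1 + ratio s).
  by move=> /(ratio_gt0 hx hgamma) V0; rewrite ln_ge0//; lra.
have f1 s : size s = 1%N -> 0 <= f s.
  case: s => [|c [|//]]// _; rewrite /f [past _ _]/=.
  by have := ln0 [:: c] isT; lra.
have fn c s : (1 <= size s)%N -> ok s -> 0 <= f (c :: s).
  move=> _; rewrite /ok /f [past _ (_ :: _)]/= => oks.
  by have := ln0 (c :: s) isT; lra.
have fs s : (1 <= size s)%N -> ok s -> step f s + 0 <= f s.
  by move=> hs _; exact: (log_ratio_drift pB_gt0 hpBA pA_lt1 hx hgamma).
apply: filterS (lyapunov (fun=> lexx 0) f1 fn fs) => w Hw okw.
have [l Hl] := Hw okw; exists (expR l) => n n0.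
have := (Hl n n0).1; rewrite /f.
have V0 : 0 < ratio (hist n w) by apply: (ratio_gt0 hx hgamma); rewrite size_hist.
have l0 := load_ge0 pB_gt0 hpBA pA_lt1 hx hgamma (hist n w).
have := okw n n0 => okn hln.
have : ln (1 + ratio (hist n w)) <= l by lra.
rewrite -ler_expR lnK ?posrE; last by lra.
by lra.
Qed.

(** As long as the ratio is at most L and the total load at most K, the concave quadratic
    potential of ratio_variance is nonnegative and pays for each term of the sum. *)
Lemma ae_bad_moves_summable K L : 0 <= K -> 0 <= L ->
  {ae P, forall w,
    (forall n, (0 < n)%N -> past load (hist n w) + load (hist n w) <= K) ->
    (forall n, (0 < n)%N -> ratio (hist n w) <= L) ->
    exists l, forall n, (0 < n)%N ->
      \sum_(1 <= k < n) pB * pos (hist k w) ^+ 2 * (1 - pos (hist k w)) <= l}.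
Proof.
move=> K0 L0; have pB0 := pB_gt0; have /andP[g10 _] := hgamma (ltn0Sn 0).
have ig : 0 < (gamma 1)^-1 by rewrite invr_gt0.
(* K1 dominates the ratio at time 1 and at every time when ok has just failed. *)
pose K1 := L * (K + 2) + 1 + (gamma 1)^-1.
have LK : L <= K1.
  have : 0 <= L * (K + 1) by apply: mulr_ge0; lra.
  by rewrite /K1; lra.
pose ok s := (past load s + load s <= K) && (ratio s <= L).
pose f s : R := 2 * K1 * ratio s - ratio s ^+ 2 + 2 * K1 * L * (K - past load s).
pose g s : R := pB * pos s ^+ 2 * (1 - pos s).
have g0 s : 0 <= g s.
  by have [t0 t1] := posP s; rewrite /g !mulr_ge0 ?sqr_ge0//; lra.
have fge s : (0 < size s)%N -> ratio s <= K1 -> past load s <= K -> 0 <= f s.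
  move=> s0 VK HK; have V0 := ratio_gt0 hx hgamma s0.
  have h1 : 0 <= ratio s * (2 * K1 - ratio s) by apply: mulr_ge0; lra.
  have h2 : 0 <= 2 * K1 * L * (K - past load s) by rewrite !mulr_ge0//; lra.
  by rewrite /f; lra.
have f1 s : size s = 1%N -> 0 <= f s.
  case: s => [|c [|//]]// _; apply: fge => //; last by rewrite /= addr0.
  apply: (@le_trans _ _ (gamma 1)^-1).
    have [t0 t1] := posP [:: c].
    by rewrite /ratio ler_pdivrMr// mulVf ?gt_eqF//; lra.
  have : 0 <= L * (K + 2) by apply: mulr_ge0; lra.
  by rewrite /K1; lra.
have fn c s : (1 <= size s)%N -> ok s -> 0 <= f (c :: s).
  move=> hs /andP[oks VL]; apply: fge => //.
    have := ratio_next pB_gt0 hpBA pA_lt1 hx hgamma c hs oks VL.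
    by rewrite /K1; lra.
have fs s : (1 <= size s)%N -> ok s -> step f s + g s <= f s.
  move=> hs /andP[oks VL].
  exact: (ratio_variance pB_gt0 hpBA pA_lt1 hx hgamma hs oks VL LK).
apply: filterS (lyapunov g0 f1 fn fs) => w Hw okw Vw.
have [|l Hl] := Hw; first by move=> n n0; rewrite /ok okw// Vw.
by exists l => n n0; exact: (Hl n n0).2.
Qed.

(** The bounds of the previous lemmas hold almost surely for all integer values of K
    and L at once; on the event, some pair of integers applies. *)
Lemma summable_at_one Xoo :
  (\sum_(1 <= n <oo) (gamma n * Num.max (eps n) 0)%:E < +oo)%E ->
  as_limit P bandit Xoo ->
  {ae P, forall w, Xoo w = 1 -> (\sum_(0 <= n <oo) (1 - bandit n w)%:E < +oo)%E}.
Proof.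
move=> epsS limX; have pip := hpBA; have pB0 := pB_gt0.
have e0 n : (0 < n)%N -> 0 <= gamma n * Num.max (eps n) 0.
  move=> /hgamma /andP[g0 _].
  by apply: mulr_ge0; [exact: ltW|rewrite le_max lexx orbT].
have [S HS] := nneseries_bounded e0 epsS.
have S0 : 0 <= S by have := HS 0%N; rewrite big_geq.
have aeK : {ae P, forall w, forall K : nat,
    (forall n, (0 < n)%N -> past load (hist n w) + load (hist n w) <= K%:R) ->
    exists l, forall n, (0 < n)%N -> ratio (hist n w) <= l}.
  by apply/ae_foralln => K; exact: ae_ratio_bounded.
have aeKL : {ae P, forall w, forall K L : nat,
    (forall n, (0 < n)%N -> past load (hist n w) + load (hist n w) <= K%:R) ->
    (forall n, (0 < n)%N -> ratio (hist n w) <= L%:R) ->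
    exists l, forall n, (0 < n)%N ->
      \sum_(1 <= k < n) pB * pos (hist k w) ^+ 2 * (1 - pos (hist k w)) <= l}.
  apply/ae_foralln => K; apply/ae_foralln => L; exact: ae_bad_moves_summable.
have {}limX : {ae P, forall w, bandit n w @[n --> \oo] --> Xoo w /\
    exists l, forall n, \sum_(0 <= k < n) pi * gamma k.+1 *
      (pos (hist k w) * (1 - pos (hist k w))) <= l}.
  by apply: filterS2 limX ae_drift_summable => w; split.
apply: filterS3 limX aeK aeKL => w [Xw [l Hl]] HK HKL Xoo1.
have half_near : \forall n \near \oo, 1 / 2 < bandit n w.
  have := Xw; rewrite Xoo1 => /cvgr_gt; apply; lra.
have [m _ Hm] := half_near.
have halfP k : (m <= k)%N -> 1 / 2 < pos (hist k w).
  by move=> mk; rewrite -bandit_hist; exact: Hm.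
(* eps_k <= S / gamma_k bounds gamma_k / gamma_(k+1), which turns the summable
   gamma_(k+1) X_k (1 - X_k) into a bound for gamma_k (1 - X_k) once X_k > 1/2. *)
have gg k : (0 < k)%N -> gamma k <= (2 + S) * gamma k.+1.
  move=> k0; have /andP[g0 g1] := hgamma k0; have /andP[g'0 g'1] := hgamma (ltn0Sn k).
  have ek : gamma k * eps k <= S.
    apply: (@le_trans _ _ (gamma k * Num.max (eps k) 0)).
      by apply: ler_wpM2l; [exact: ltW|rewrite le_max lexx].
    apply: le_trans (HS k.+1); rewrite big_nat_recr//= lerDr.
    rewrite big_nat_cond sumr_ge0// => i; rewrite andbT => /andP[i0 _].
    exact: e0.
  have gp : gamma k * pi <= 1.
    by have := pB_gt0; have := pA_lt1 => *; rewrite -[leRHS]mulr1; apply: ler_pM; lra.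
  have -> : gamma k = (gamma k * eps k + 1 + gamma k * pi) * gamma k.+1.
    by rewrite /Defs.eps; field; rewrite !gt_eqF.
  by apply: ler_wpM2r; lra.
pose dr k := pi * gamma k.+1 * (pos (hist k w) * (1 - pos (hist k w))).
have dr0 k : 0 <= dr k.
  have [t0 t1] := posP (hist k w); have /andP[g0 _] := hgamma (ltn0Sn k).
  by rewrite /dr !mulr_ge0//; lra.
pose e k := if k is 0%N then 0 else gamma k * Num.max (eps k) 0.
have [|||Sl HSl] := @bounded_sum_dominated R (fun k => load (hist k w))
  (fun k => e k + (2 * (2 + S)) * dr k) 1 m.+1 (S + 2 * (2 + S) * l).
- move=> k; apply: addr_ge0; first by case: k => // k; exact: e0.
  by apply: mulr_ge0 => //; lra.
- move=> [//|k] mk; have [t0 t1] := posP (hist k.+1 w).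
  have := halfP _ (ltnW mk) => half.
  rewrite [load _](_ : _ = e k.+1 + pi * gamma k.+1 * (1 - pos (hist k.+1 w)));
    last first.
    have := size_hist k.+1 w; rewrite /load; case E: (hist k.+1 w) => [//|b s] sz.
    by rewrite sz.
  rewrite lerD2l.
  have -> : 2 * (2 + S) * dr k.+1 = pi * ((2 + S) * gamma k.+2) *
     ((2 * pos (hist k.+1 w)) * (1 - pos (hist k.+1 w))) by rewrite /dr; ring.
  have /andP[g0 g1] := hgamma (ltn0Sn k).
  apply: ler_pM.
  + by rewrite mulr_ge0//; lra.
  + by lra.
  + by apply: ler_wpM2l; [lra|exact: gg].
  + by rewrite -[leLHS]mul1r; apply: ler_wpM2r; lra.
- move=> n n0; rewrite big_split/= -mulr_sumr; apply: lerD.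
    apply: le_trans (HS n); apply: ler_sum_nat => -[//|k] _.
    by [].
  apply: ler_wpM2l; first by lra.
  apply: le_trans (Hl n); rewrite (big_cat_nat (leq0n 1) n0)/= lerDr.
  by apply: sumr_ge0 => k _; exact: dr0.
have [K HK'] : exists K : nat, forall n, (0 < n)%N ->
    past load (hist n w) + load (hist n w) <= K%:R.
  exists (Num.bound Sl) => n _.
  apply: (@le_trans _ _ Sl); last exact/ltW/unstable.ltr_bound.
  by have := HSl n.+1; rewrite big_nat_recr//= past_hist.
have [l1 Hl1] := HK K HK'.
have [|l2 Hl2] := HKL K (Num.bound l1) HK'.
  by move=> n n0; apply: le_trans (Hl1 n n0) _; exact/ltW/unstable.ltr_bound.
pose bad k := pB * pos (hist k w) ^+ 2 * (1 - pos (hist k w)).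
have [|||S2 HS2] := @bounded_sum_dominated R (fun k => 1 - bandit k w)
  (fun k => (4 / pB) * bad k) 1 m (4 / pB * l2).
- move=> k; have [t0 t1] := posP (hist k w).
  by rewrite /bad !mulr_ge0 ?invr_ge0 ?sqr_ge0//; lra.
- move=> k mk; have [t0 t1] := posP (hist k w); have half := halfP k mk.
  rewrite bandit_hist.
  have -> : 4 / pB * bad k = (2 * pos (hist k w)) ^+ 2 * (1 - pos (hist k w)).
    by rewrite /bad; field; rewrite gt_eqF.
  rewrite -[leLHS]mul1r; apply: ler_wpM2r; first by lra.
  by rewrite expr_ge1//; lra.
- move=> n n0; rewrite -mulr_sumr; apply: ler_wpM2l; last exact: Hl2.
  by rewrite divr_ge0//; lra.
apply: (nneseries_ltey _ _ HS2) => k; rewrite bandit_hist.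
by have [t0 t1] := posP (hist k w); lra.
Qed.

(** * The event where Y tends to 0 *)

Section at_zero.
Context (c : R) (n0 : nat).
Hypothesis c_gt0 : 0 < c.
Hypothesis n0_gt0 : (0 < n0)%N.
Hypothesis epsc : forall n, (n0 <= n)%N -> c <= eps n.

Lemma Ymart_hist n w : Ymart pA pB x gamma U A B n w = Y_word pA pB x gamma (hist n w).
Proof.
rewrite /Ymart /Y_word bandit_hist; congr (_ / _).
elim: n => [|n IH]; first by rewrite /theta big_geq.
by rewrite /theta big_nat_recr//= -/(theta _ _ _ _ _ _ _ n w) IH bandit_hist size_hist.
Qed.

(** If the ratio exceeds K at some time while Y tends to 0, then Y is eventually below
    half of its marked value, an event of probability of order 1 / K. *)
Lemma ae_next_ratio_bounded : {ae P, forall w,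
  Ymart pA pB x gamma U A B n w @[n --> \oo] --> (0 : R) ->
  exists K : nat, forall n, (n0 <= n)%N -> next_ratio (hist n w) <= K.+1%:R}.
Proof.
have pip := hpBA; have pB0 := pB_gt0; have pA1 := pA_lt1; have cp := c_gt0.
apply: (@null_event n0) => z z0.
pose C := 4 * (1 - pi)^-1 ^+ 2 * (1 + c^-1).
have ci : 0 < c^-1 by rewrite invr_gt0.
have pi0 : 0 < (1 - pi)^-1 by rewrite invr_gt0; lra.
have C0 : 0 < C by rewrite /C !mulr_gt0 ?exprn_gt0//; lra.
pose k := Num.bound (C / z).
have Cz : C / z < k.+1%:R.
  by apply: (lt_trans (unstable.ltr_bound _)); rewrite ltr_nat.
have K0 : 0 < k.+1%:R :> R by rewrite ltr0n.
exists (halving pA pB x gamma c n0 k.+1%:R); split.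
- exact: (halving_super pB_gt0 hpBA pA_lt1 hx hgamma c_gt0 epsc K0).
- move=> s hs; apply: le_trans.
    exact: (halving_start pB_gt0 hpBA pA_lt1 hx hgamma c_gt0 K0 hs).
  by rewrite -/C ler_pdivrMr// mulrC -ler_pdivrMr// ltW.
move=> w /= /not_implyP[Y0 nK].
have [n [nn Kn]] : exists n, (n0 <= n)%N /\ k.+1%:R < next_ratio (hist n w).
  apply: contrapT => nex; apply: nK; exists k => n nn; rewrite leNgt.
  by apply/negP => Kn; apply: nex; exists n.
case E : (mark pA pB x gamma n0 k.+1%:R (hist n w)) => [y|]; last first.
  by case: (mark_hit Kn E).
have y0 := mark_gt0 pB_gt0 hpBA pA_lt1 hx hgamma E.
have [m _ Hm] : \forall N \near \oo, Ymart pA pB x gamma U A B N w < y / 2.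
  by apply: (cvgr_lt _ Y0); rewrite divr_gt0.
exists (maxn n m) => N; rewrite geq_max => /andP[nN mN].
apply: (halving_ge1 pB_gt0 hpBA pA_lt1 hx hgamma c_gt0 (y := y)); last first.
  by rewrite -Ymart_hist ltW//; exact: Hm.
rewrite -(subnK nN); elim: (N - n)%N => [|j IH]; first by rewrite add0n.
rewrite addSn; apply: mark_stays => //.
by rewrite size_hist (leq_trans nn)// leq_addl.
Qed.

(** A constant minus the ratio is a bounded potential that loses c (1 - X) at each
    step. *)
Lemma ae_summable_of_next_ratio_bounded K : 0 <= K -> {ae P, forall w,
  (forall n, (n0 <= n)%N -> next_ratio (hist n w) <= K) ->
  (\sum_(0 <= n <oo) (1 - bandit n w)%:E < +oo)%E}.
Proof.
move=> K0; have cp := c_gt0; have /andP[gn0 _] := hgamma n0_gt0.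
have ig : 0 < (gamma n0)^-1 by rewrite invr_gt0.
(* M dominates the ratio at time n0 and at every time when ok has just failed. *)
pose M := K + 1 + (gamma n0)^-1.
pose ok s := next_ratio s <= K.
pose f s : R := M - ratio s.
pose g s : R := c * (1 - pos s).
have g0 s : 0 <= g s by have [t0 t1] := posP s; rewrite /g mulr_ge0//; lra.
have f1 s : size s = n0 -> 0 <= f s.
  move=> hs; have [t0 t1] := posP s; rewrite /f subr_ge0 /ratio hs.
  apply: (@le_trans _ _ (gamma n0)^-1); last by rewrite /M; lra.
  by rewrite ler_pdivrMr// mulVf ?gt_eqF//; lra.
have fn b s : (n0 <= size s)%N -> ok s -> 0 <= f (b :: s).
  move=> _; rewrite /ok => oks; have := ratio_next_le hx hgamma s b.
  by rewrite /f /M; lra.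
have fs s : (n0 <= size s)%N -> ok s -> step f s + g s <= f s.
  by move=> hs _; exact: (ratio_drift_ge pB_gt0 hpBA pA_lt1 hx hgamma n0_gt0 epsc).
apply: filterS (lyapunov g0 f1 fn fs) => w Hw okw; have [l Hl] := Hw okw.
have [|||S HS] := @bounded_sum_dominated R (fun k => 1 - bandit k w)
  (fun k => c^-1 * g (hist k w)) n0 0 (c^-1 * l).
- by move=> k; rewrite mulr_ge0 ?invr_ge0//; lra.
- by move=> k _; rewrite bandit_hist /g mulKf ?gt_eqF.
- move=> n nn; rewrite -mulr_sumr; apply: ler_wpM2l; last exact: (Hl n nn).2.
  by rewrite invr_ge0; lra.
apply: (nneseries_ltey _ _ HS) => k; rewrite bandit_hist.
by have [t0 t1] := posP (hist k w); lra.
Qed.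

Lemma summable_at_zero Yoo : as_limit P (Ymart pA pB x gamma U A B) Yoo ->
  {ae P, forall w, Yoo w = 0 -> (\sum_(0 <= n <oo) (1 - bandit n w)%:E < +oo)%E}.
Proof.
have aeK : {ae P, forall w, forall K : nat,
    (forall n, (n0 <= n)%N -> next_ratio (hist n w) <= K.+1%:R) ->
    (\sum_(0 <= n <oo) (1 - bandit n w)%:E < +oo)%E}.
  by apply/ae_foralln => K; exact: ae_summable_of_next_ratio_bounded.
move=> limY; apply: filterS3 limY ae_next_ratio_bounded aeK => w Ycvg HY HK Y0.
by rewrite Y0 in Ycvg; have [K HKw] := HY Ycvg; exact: HK HKw.
Qed.
End at_zero.

End history.

Theorem proposition7 (R : realType) (d : measure_display)
  (T : measurableType d) (P : probability T R)
  (pA pB : R) (hpB : 0 < pB) (hpBA : pB < pA) (hpA : pA < 1)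
  (gamma : nat -> R)
  (hgamma : forall n, (0 < n)%N -> 0 < gamma n < 1)
  (hGamma : Gamma gamma n @[n --> \oo] --> +oo)
  (U : nat -> {RV P >-> R}) (A B : nat -> set T)
  (hUlaw : forall n, (0 < n)%N -> forall S : set R, measurable S ->
     distribution P (U n) S = uniform_prob (@ltr01 R) S)
  (hUind : independent_seq P (fun n => U n : T -> R))
  (mA : forall n, (0 < n)%N -> measurable (A n))
  (mB : forall n, (0 < n)%N -> measurable (B n))
  (hPA : forall n, (0 < n)%N -> P (A n) = pA%:E)
  (hPB : forall n, (0 < n)%N -> P (B n) = pB%:E)
  (hABind : independent_seq P (@indic_pair R T A B))
  (hABU : independent_classes P (sigma_seq (@indic_pair R T A B))
     (sigma_seq (fun n => U n : T -> R)))
  (x : R) (hx : 0 < x < 1) :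
  let X := bandit x gamma U A B in
  let Y := Ymart pA pB x gamma U A B in
  ((\sum_(1 <= n <oo) (gamma n * Num.max (eps pA pB gamma n) 0)%:E < +oo)%E ->
   forall Xoo : {RV P >-> R}, as_limit P X Xoo ->
     {ae P, forall w, Xoo w = 1 ->
        (\sum_(0 <= n <oo) (1 - X n w)%:E < +oo)%E})
  /\
  ((0 < limn_einf (fun n => (eps pA pB gamma n)%:E))%E ->
   (\sum_(1 <= n <oo)
      (gamma n ^+ 2 * expR ((pA - pB) * Gamma gamma n))%:E < +oo)%E
   /\
   forall Yoo : {RV P >-> R}, as_limit P Y Yoo ->
     {ae P, forall w, Yoo w = 0 ->
        (\sum_(0 <= n <oo) (1 - X n w)%:E < +oo)%E}).
Proof.
move=> X Y; have pA01 : 0 < pA < 1 by rewrite hpA andbT (lt_trans hpB).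
have pB01 : 0 < pB < 1 by rewrite hpB (lt_trans hpBA).
split.
  move=> epsS Xoo limX.
  exact: (summable_at_one pA01 pB01 hx hgamma hUlaw hUind mA mB hPA hPB hABind
    hABU hpBA epsS limX).
move=> /limn_einf_gt0[c [n0 [c0 n0_gt0 epsc]]]; split.
  exact: weighted_square_sum c0 n0_gt0 hgamma epsc.
move=> Yoo limY.
exact: (summable_at_zero pA01 pB01 hx hgamma hUlaw hUind mA mB hPA hPB hABind
  hABU hpBA c0 n0_gt0 epsc limY).
Qed.
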